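(* Let $N\in\{1,2\}$. If $\phi\in H^1_{loc}(\mathbb{R}^N)$ is a locally integrable solution of $$\Delta^2\phi+\Delta\phi+\frac12|\nabla\phi|^2=0\quad\text{in }\mathbb{R}^N,$$ then $\phi$ is constant. That is, the only locally integrable solutions of this equation are the trivial ones, $\phi=\text{constant}$.
   Context: A real-valued function $\phi\in H^1_{loc}(\mathbb{R}^N)$ is called a locally integrable solution of the equation in $\mathbb{R}^N$ if it satisfies the equation in the sense of distributions, i.e., in $\mathcal{D}'(\mathbb{R}^N)$. No boundary condition or growth condition on $\phi$ as $|x|\to\infty$ is imposed. Equality of functions is understood almost everywhere. *)

(* Defs.v *)
From HB Require Import structures.
From mathcomp Require Import all_boot all_order all_algebra.
From mathcomp Require Import all_classical all_reals all_analysis.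

Set Implicit Arguments.
Unset Strict Implicit.
Unset Printing Implicit Defensive.

Import Order.TTheory GRing.Theory Num.Theory.
Import numFieldTopology.Exports numFieldNormedType.Exports.

Local Open Scope classical_set_scope.
Local Open Scope ring_scope.

(* Row vectors carry the sigma-algebra generated by the coordinates, as
   n.-tuple T does in the library; for T := R this is the Borel one. *)
Definition measure_rV_display : measure_display -> measure_display.
Proof. exact. Qed.

Section measurable_rV.
Context d (T : measurableType d) (n : nat).

Let coors : 'I_n -> 'rV[T]_n -> T := fun i x => x ord0 i.

Let rV_set0 : g_sigma_preimage coors set0.
Proof. exact: sigma_algebra0. Qed.

Let rV_setC A : g_sigma_preimage coors A -> g_sigma_preimage coors (~` A).
Proof. exact: sigma_algebraC. Qed.

Let rV_bigcup (F : _^nat) : (forall i, g_sigma_preimage coors (F i)) ->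
  g_sigma_preimage coors (\bigcup_i (F i)).
Proof. exact: sigma_algebra_bigcup. Qed.

HB.instance Definition _ := @isMeasurable.Build (measure_rV_display d)
  'rV[T]_n (g_sigma_preimage coors) rV_set0 rV_setC rV_bigcup.

End measurable_rV.

Lemma measurable_coord d (T : measurableType d) n (i : 'I_n) :
  measurable_fun [set: 'rV[T]_n] (fun x => x ord0 i).
Proof.
move=> _ Y mY; rewrite setTI; apply: sub_sigma_algebra => /=.
rewrite -bigcup_seq/=; exists i => /=; first by rewrite mem_index_enum.
by exists Y => //; rewrite setTI.
Qed.

Lemma measurable_fun_rV d d' (T : measurableType d) (S : measurableType d') n
    (f : S -> 'rV[T]_n) :
  (forall i, measurable_fun [set: S] (fun s => f s ord0 i)) ->
  measurable_fun [set: S] f.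
Proof.
move=> mf; apply: (measurability
  (\big[setU/set0]_(i < n) preimage_set_system setT
     (fun x : 'rV[T]_n => x ord0 i) measurable)) => //.
move=> A [B]; rewrite -bigcup_seq => -[i _ [C mC <-{B}]] <-{A}.
by rewrite !setTI; rewrite -[X in measurable X]setTI; exact: mf.
Qed.

Section lebesgue_measure_rV.
Context {R : realType}.

Definition rV_cons n (p : measurableTypeR R * 'rV[R]_n) : 'rV[R]_n.+1 :=
  row_mx (const_mx p.1 : 'rV[R]_1) p.2.

Lemma rV_cons0 n p : @rV_cons n p ord0 ord0 = p.1.
Proof.
rewrite (_ : ord0 = (@lshift 1 n ord0 : 'I_n.+1)); last exact: val_inj.
by apply: (etrans (row_mxEl _ _ _ _)); rewrite mxE.
Qed.

Lemma rV_consS n p i : @rV_cons n p ord0 (lift ord0 i) = p.2 ord0 i.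
Proof.
rewrite (_ : lift _ _ = (@rshift 1 n i : 'I_n.+1)); last exact: val_inj.
exact: row_mxEr.
Qed.

Lemma measurable_rV_cons n : measurable_fun setT (@rV_cons n).
Proof.
apply: measurable_fun_rV => i; case: (unliftP ord0 i) => [j|] ->.
- apply: (eq_measurable_fun
    (fun p : measurableTypeR R * 'rV[R]_n => p.2 ord0 j)).
    by move=> p _; rewrite rV_consS.
  apply: (@measurableT_comp _ _ _ _ _ _ (fun x : 'rV[R]_n => x ord0 j)) => //.
  exact: measurable_coord.
- by apply: (eq_measurable_fun fst) => // p _; rewrite rV_cons0.
Qed.

Section cons.
Variables (n : nat) (m : {sigma_finite_measure set 'rV[R]_n -> \bar R}).

Definition lebesgue_cons : set 'rV[R]_n.+1 -> \bar R :=
  pushforward (@lebesgue_measure R \x m)%E (@rV_cons n).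

Let lebesgue_cons0 : lebesgue_cons set0 = 0%E.
Proof. by rewrite /lebesgue_cons /pushforward preimage_set0 measure0. Qed.

Let lebesgue_cons_ge0 A : (0 <= lebesgue_cons A)%E.
Proof. by rewrite /lebesgue_cons /pushforward; exact: measure_ge0. Qed.

Let lebesgue_cons_sigma_additive : semi_sigma_additive lebesgue_cons.
Proof.
move=> F mF tF mUF; rewrite /lebesgue_cons /pushforward preimage_bigcup.
apply: measure_semi_sigma_additive.
- by move=> k; rewrite -[X in measurable X]setTI; exact: measurable_rV_cons.
- apply/trivIsetP => /= i j _ _ ij; rewrite -preimage_setI.
  by move/trivIsetP : tF => /(_ _ _ _ _ ij) ->//; rewrite preimage_set0.
- by rewrite -preimage_bigcup -[X in measurable X]setTI;
    exact: measurable_rV_cons.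
Qed.

HB.instance Definition _ := isMeasure.Build _ _ _ lebesgue_cons
  lebesgue_cons0 lebesgue_cons_ge0 lebesgue_cons_sigma_additive.

Let lebesgue_cons_sigma_finite : sigma_finite setT lebesgue_cons.
Proof.
have [F UF mF] : sigma_finite setT (@lebesgue_measure R \x m)%E.
  have /sigma_finiteP[G [TG ndG Goo]] := sigma_finiteT (@lebesgue_measure R).
  have /sigma_finiteP[H [TH ndH Hoo]] := sigma_finiteT m.
  exists (fun k => G k `*` H k).
    rewrite -setXTT TG TH predeqE => -[x y]; split.
      move=> [/= [i _ Gix] [j _ Hjy]]; exists (maxn i j) => //; split.
      - by move: x Gix; exact/subsetPset/ndG/leq_maxl.
      - by move: y Hjy; exact/subsetPset/ndH/leq_maxr.
    by move=> [i _ []/= ? ?]; split; exists i.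
  move=> k; have [? ?] := Goo k; have [? ?] := Hoo k.
  split; first exact: measurableX.
  by rewrite product_measure1E// lte_mul_pinfty// ge0_fin_numE.
pose uncons (x : 'rV[R]_n.+1) : measurableTypeR R * 'rV[R]_n :=
  (x ord0 ord0, @rsubmx R 1 1 n x).
have rV_consK : cancel (@rV_cons n) uncons.
  move=> [a y]; congr pair; last exact: row_mxKr.
  by rewrite rV_cons0.
have muncons : measurable_fun setT uncons.
  apply/measurable_fun_pair; first exact: measurable_coord.
  apply: measurable_fun_rV => i.
  apply: (eq_measurable_fun (fun x : 'rV[R]_n.+1 => x ord0 (rshift 1 i))).
    by move=> x _; rewrite mxE.
  exact: measurable_coord.
exists (fun k => uncons @^-1` F k).
  by rewrite -preimage_bigcup -UF preimage_setT.
move=> k; have [mFk Fk] := mF k; split.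
  by rewrite -[X in measurable X]setTI; exact: muncons.
rewrite /lebesgue_cons /pushforward -comp_preimage.
by rewrite (_ : uncons \o _ = id) ?preimage_id//; apply/funext.
Qed.

HB.instance Definition _ := Measure_isSigmaFinite.Build _ _ _ lebesgue_cons
  lebesgue_cons_sigma_finite.

End cons.

(* N-dimensional Lebesgue measure as the iterated product of the
   one-dimensional one, transported along R * R^n -> R^n.+1. *)
Fixpoint lebesgue_rV n : {sigma_finite_measure set 'rV[R]_n -> \bar R} :=
  if n is k.+1 then lebesgue_cons (lebesgue_rV k) else \d_(0 : 'rV[R]_0).

Lemma lebesgue_rV_box n (A : 'I_n -> set R) :
  (forall i, measurable (A i)) ->
  lebesgue_rV n [set x : 'rV[R]_n | forall i, A i (x ord0 i)] =
  (\prod_(i < n) lebesgue_measure (A i))%E.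
Proof.
elim: n A => [|n IH] A mA.
  by rewrite big_ord0 /= diracE mem_set// => -[].
have mB : measurable
    [set x : 'rV[R]_n | forall i, A (lift ord0 i) (x ord0 i)].
  rewrite (_ : mkset _ =
      \big[setI/setT]_(i < n) ((fun x : 'rV[R]_n => x ord0 i) @^-1`
        A (lift ord0 i))).
    apply: bigsetI_measurable => i _.
    by rewrite -[X in measurable X]setTI; exact: measurable_coord.
  rewrite -bigcap_seq; apply/seteqP; split=> x /= Ax i; first by move=> _.
  by apply: Ax; rewrite /= mem_index_enum.
rewrite big_ord_recl -IH// -product_measure1E//=; last exact: mA.
rewrite /lebesgue_cons /pushforward; congr (_ _).
apply/seteqP; split=> -[a y] /=.
  move=> Ay; split=> [|i] /=; first by have := Ay ord0; rewrite rV_cons0.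
  by have := Ay (lift ord0 i); rewrite rV_consS.
move=> [/= Aa Ay] i; case: (unliftP ord0 i) => [j|] ->.
  by rewrite rV_consS.
by rewrite rV_cons0.
Qed.

End lebesgue_measure_rV.

Section distributions.
Context {R : realType} {N : nat}.
Implicit Types (f u eta : 'rV[R]_N -> R) (T : ('rV[R]_N -> R) -> R)
  (g : 'I_N -> 'rV[R]_N -> R).

Local Notation leb := (@lebesgue_rV R N).

Definition partial (i : 'I_N) f : 'rV[R]_N -> R :=
  'D_(delta_mx ord0 i : 'rV[R]_N) f.

(* partial_seq [:: i1; i2; ...] f is the derivative of f with respect to
   x_i1, x_i2, ..., the last entry being applied first. *)
Definition partial_seq (s : seq 'I_N) f : 'rV[R]_N -> R := foldr partial f s.

Definition smooth f := forall s : seq 'I_N,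
  continuous (partial_seq s f) /\
  forall i x, derivable (partial_seq s f) x (delta_mx ord0 i : 'rV[R]_N).

Definition compact_support f := compact (closure [set x | f x != 0]).

Definition test_function eta := smooth eta /\ compact_support eta.

(* Only the values of a functional on test functions are meaningful. *)
Definition distr_of f : ('rV[R]_N -> R) -> R :=
  fun eta => \int[leb]_x (f x * eta x).

Definition distr_partial (i : 'I_N) T : ('rV[R]_N -> R) -> R :=
  fun eta => - T (partial i eta).

Definition distr_laplacian T : ('rV[R]_N -> R) -> R :=
  fun eta => \sum_(i < N) distr_partial i (distr_partial i T) eta.

Definition Lp_loc (p : nat) f := measurable_fun setT f /\
  forall K : set 'rV[R]_N, compact K ->
    (\int[leb]_(x in K) (`|f x| ^+ p)%:E < +oo)%E.

Definition weak_gradient u g := [/\ Lp_loc 1 u, forall i, Lp_loc 1 (g i) &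
  forall i eta, test_function eta ->
    distr_partial i (distr_of u) eta = distr_of (g i) eta].

Definition H1_loc u := Lp_loc 2 u /\
  exists2 g, weak_gradient u g & forall i, Lp_loc 2 (g i).

Definition sqnorm g : 'rV[R]_N -> R := fun x => \sum_(i < N) g i x ^+ 2.

(* Delta^2 u + Delta u + 1/2 |nabla u|^2 = 0 in D'(R^N). The weak gradient is
   determined up to a null set, so the choice of g is immaterial. *)
Definition distr_solution u := exists g, [/\ weak_gradient u g,
  Lp_loc 1 (sqnorm g) &
  forall eta, test_function eta ->
    distr_laplacian (distr_laplacian (distr_of u)) eta
    + distr_laplacian (distr_of u) eta
    + 2^-1 * distr_of (sqnorm g) eta = 0].

End distributions.

(* Main.v *)
Require Import Defs.
From HB Require Import structures.
From mathcomp Require Import all_boot all_order all_algebra.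
From mathcomp Require Import all_classical all_reals all_analysis.
From mathcomp Require Import measurable_realfun ring lra.

(** Write q = |nabla phi|^2.  Testing the equation against eta >= 0 and
    integrating by parts once in each term gives
      1/2 \int q eta = \int nabla phi . nabla (Delta eta + eta),
    an identity in which phi occurs only through its gradient
    ([energy_identity]).

    Take for eta a cutoff eta_r equal to 1 on the cube of half-side 2r and
    supported in the cube of half-side 6r.  If the profile of the cutoff is a
    sixth power, each partial derivative z of eta_r of order 1, 2 or 3 satisfies
    z^2 <= (C / r^2) eta_r for r >= 1 ([partial_seq_dilate_sqr]), because three
    differentiations of h^6 leave a factor h^3, whose square is h^6 again.  Such
    a z vanishes outside the annulus between the cubes of half-sides r and 6r,
    whose volume is O(r^2) because N <= 2.  So with E the integral of q eta_r
    and J the part of it over the annulus, Young's inequality yields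
      E <= K (a J + 1/a)   for every a > 0,
    with K independent of r and a.  A small a absorbs J <= E and bounds E
    uniformly, so q is integrable; then J tends to 0 along r = 6^k, and letting
    first r, then a, go to infinity gives \int q = 0
    ([hole_filling_vanishes], [energy_vanishes]).  This is where low dimension
    enters: the term 1/a stands for vol(annulus) / (a r^2).

    It remains to see that a function u with vanishing weak gradient is
    constant.  Let L(F) be the integral of u times the product of the F_i(x_i).
    Since L vanishes as soon as one factor is the derivative of a compactly
    supported function, F_i may be replaced by (\int F_i) rho, where rho has
    integral 1 ([distr_of_swap]); hence L(F) = c \prod_i \int F_i.  Letting
    the F_i increase to indicators of intervals, u has mean value c on every
    open box ([Rintegral_open_box]), and boxes generate the measurable sets, so
    u = c almost everywhere ([ae_eq0_of_open_box]).

    All the test functions used are products of functions of one coordinate, so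
    that smoothness in several variables, measurability and supports reduce to
    calculus on the line, where everything is built from exp(-1/x). *)

Set Implicit Arguments.
Unset Strict Implicit.
Unset Printing Implicit Defensive.
Set Bullet Behavior "Strict Subproofs".
Import Order.TTheory GRing.Theory Num.Theory.
Import numFieldTopology.Exports numFieldNormedType.Exports.

Local Open Scope ring_scope.
Local Open Scope classical_set_scope.

(** * Smooth functions of one variable *)
Section one_variable.
Context {R : realType}.
Implicit Types (f g : R -> R) (p : {poly R}).

Lemma poly_expRN_bounded p :
  exists2 C, 0 <= C & forall t, 0 <= t -> `|p.[t]| * expR (- t) <= C.
Proof.
exists (\sum_(i < size p) `|p`_i| * i`!%:R).
  by apply: sumr_ge0 => i _; rewrite mulr_ge0.
move=> t t0; rewrite horner_coef.
have -> : expR (- t) = `|expR (- t)| by rewrite ger0_norm ?expR_ge0.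
rewrite -normrM mulr_suml (le_trans (ler_norm_sum _ _ _))//.
apply: ler_sum => i _; rewrite !normrM -mulrA ler_wpM2l//.
rewrite !ger0_norm ?expR_ge0 ?exprn_ge0//.
rewrite expRN ler_pdivrMr ?expR_gt0//.
case: i => -[|i] _ /=; first by rewrite expr0 fact0 mul1r -expR0 ler_expR.
have := expR_ge1Dxn i t0; rewrite -ler_pdivrMl ?ltr0n ?fact_gt0//.
by rewrite mulrC => H; apply: le_trans H; rewrite lerDr.
Qed.

(** The family p(1/x) exp(-1/x), extended by 0 to x <= 0, is closed under
    differentiation; p = 1 is the classical flat function. *)
Definition flat p (x : R) := if 0 < x then p.[x^-1] * expR (- x^-1) else 0.

Lemma flat_le0 p x : x <= 0 -> flat p x = 0.
Proof. by rewrite /flat leNgt => /negbTE ->. Qed.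

(** Dividing by x stays in the family, so boundedness of one member gives
    decay of another at 0: this is how continuity and differentiability at 0 are
    obtained below. *)
Lemma flat_mulX p x : flat ('X * p) x = x^-1 * flat p x.
Proof.
rewrite /flat; case: ifPn => _; last by rewrite mulr0.
by rewrite hornerM hornerX mulrA.
Qed.

Lemma flat_bounded p : exists2 C, 0 <= C & forall x, `|flat p x| <= C.
Proof.
have [C C0 HC] := poly_expRN_bounded p; exists C => // x.
rewrite /flat; case: ifPn => x0; last by rewrite normr0.
rewrite normrM (ger0_norm (expR_ge0 _)).
by apply: HC; rewrite invr_ge0 ltW.
Qed.

Lemma flat_continuous0 p : {for 0, continuous (flat p)}.
Proof.
have [C C0 HC] := flat_bounded ('X * p).
rewrite /prop_for/= /continuous_at (flat_le0 p (lexx 0)).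
have zC z : `|flat p z| <= C * `|z|.
  have [->|z0] := eqVneq z 0; first by rewrite (flat_le0 p (lexx 0)) normr0 mulr0.
  have -> : flat p z = flat ('X * p) z * z.
    by rewrite flat_mulX mulrC mulrA divff// mul1r.
  by rewrite normrM ler_wpM2r.
apply/norm_cvg0P.
apply: (@squeeze_cvgr _ _ _ _ (cst 0) (fun z => C * `|z|)).
- by near=> z; rewrite normr_ge0 zC.
- exact: cvg_cst.
- rewrite -[X in _ --> X](mulr0 C); apply: cvgMr.
  by rewrite -[X in _ --> X](@normr0 _ R); apply: cvg_norm; exact: cvg_id.
Unshelve. all: by end_near. Qed.

Lemma is_derive_flat p (x : R) :
  is_derive x 1 (flat p) (flat ('X^2 * (p - p^`()%R)) x).
Proof.
have [x0|x0|->] := ltgtP x 0.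
- rewrite flat_le0 ?ltW//; apply: (@near_eq_is_derive _ _ _ (cst 0)).
    by near=> z; rewrite flat_le0//; near: z; exact: lt_le_nbhsl.
- pose F z := p.[z^-1] * expR (- z^-1).
  apply: (@near_eq_is_derive _ _ _ F).
    by near=> z; rewrite /flat ifT//; near: z; exact: lt_nbhsr.
  have dV : is_derive x 1 (fun y : R => y^-1) (- x ^- 2 *: 1).
    by apply: is_deriveV; rewrite ?gt_eqF//; exact: is_derive_id.
  have dE : is_derive x 1 (fun y : R => expR (- y^-1)) (expR (- x^-1) * x ^- 2).
    apply: (@is_derive1_comp _ expR (fun y => - y^-1)).
    rewrite -[x ^- 2]mulr1 -[x ^- 2 * 1]opprK -mulNr; exact: is_deriveN.
  have dP : is_derive x 1 (fun y : R => p.[y^-1]) (p^`()%R.[x^-1] * - x ^- 2).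
    apply: (@is_derive1_comp _ (horner p) (fun y => y^-1)).
    by apply: is_derive_eq; rewrite /GRing.scale/= mulr1.
  apply: is_derive_eq.
  rewrite /flat x0 /GRing.scale/= !hornerE.
  rewrite /= exprVn; ring.
- rewrite flat_le0//; apply/is_derive1_caratheodory.
  exists (flat ('X * p)); split; last by rewrite flat_le0.
    move=> z; rewrite subr0 (flat_le0 p (lexx 0)) subr0 flat_mulX mulrC mulrA.
    have [->|z0] := eqVneq z 0; first by rewrite !mul0r flat_le0.
    by rewrite divff// mul1r.
  exact: flat_continuous0.
Unshelve. all: by end_near. Qed.

Lemma is_derive_affine a b (x : R) : is_derive x 1 (fun y => a * y + b) a.
Proof.
have -> : (fun y : R => a * y + b) = a *: id + cst b by [].
by apply: is_derive_eq; rewrite addr0 /GRing.scale/= mulr1.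
Qed.

(** A class of functions generated by the operations needed here and closed
    under differentiation; its members are therefore infinitely
    differentiable, with no need for a Leibniz formula.  Closure under
    antiderivatives is what allows plateau functions and the primitives of
    functions with integral zero. *)
Inductive cinf : (R -> R) -> Prop :=
| cinf_cst c : cinf (cst c)
| cinf_flat p : cinf (flat p)
| cinf_affine a b f : cinf f -> cinf (fun x => f (a * x + b))
| cinf_add f g : cinf f -> cinf g -> cinf (f \+ g)
| cinf_mul f g : cinf f -> cinf g -> cinf (f \* g)
| cinf_primitive f g : cinf g -> (forall x : R, is_derive x 1 f (g x)) -> cinf f.

Lemma cinf_is_derive f : cinf f ->
  exists2 g, cinf g & forall x : R, is_derive x 1 f (g x).
Proof.
elim=> {f}.
- by move=> c; exists (cst 0) => [|x]; [exact: cinf_cst|exact: is_derive_cst].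
- move=> p; exists (flat ('X^2 * (p - p^`()%R))); first exact: cinf_flat.
  exact: is_derive_flat.
- move=> a b f cf [g cg fg]; exists (fun x => g (a * x + b) * a).
    apply: (@cinf_mul (fun x => g (a * x + b)) (cst a)); last exact: cinf_cst.
    exact: cinf_affine.
  move=> x; apply: (@is_derive1_comp _ f (fun x => a * x + b)).
  exact: is_derive_affine.
- move=> f g cf [f' cf' ff'] cg [g' cg' gg'].
  exists (f' \+ g'); first exact: cinf_add.
  by move=> x; exact: is_deriveD.
- move=> f g cf [f' cf' ff'] cg [g' cg' gg'].
  exists ((f \* g') \+ (g \* f')); first by apply: cinf_add; exact: cinf_mul.
  by move=> x; exact: is_deriveM.
- by move=> f g cg _ fg; exists g.
Qed.

Lemma cinf_derivable f (x : R) : cinf f -> derivable f x 1.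
Proof. by move=> /cinf_is_derive[g _ /(_ x)[]]. Qed.

Lemma cinf_continuous f : cinf f -> continuous f.
Proof.
move=> cf x; apply/differentiable_continuous/derivable1_diffP.
exact: cinf_derivable.
Qed.

Lemma is_derive_derive1 f g : (forall x : R, is_derive x 1 f (g x)) -> f^`() = g.
Proof. by move=> fg; apply/funext => x; rewrite derive1E derive_val. Qed.

Lemma cinf_derive1 f : cinf f -> cinf f^`().
Proof. by move=> /cinf_is_derive[g cg /is_derive_derive1 ->]. Qed.

Lemma cinf_derive1n n f : cinf f -> cinf f^`(n).
Proof. by move=> cf; elim: n => [//|n IH]; exact: cinf_derive1. Qed.

Lemma cinf_scale f k : cinf f -> cinf (fun x => f (x / k)).
Proof.
move=> cf; rewrite (_ : (fun x => _) = (fun x => f (k^-1 * x + 0))).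
  exact: cinf_affine.
by apply/funext => x; rewrite addr0 mulrC.
Qed.

Lemma derive1n_scale f k n : cinf f ->
  (fun x => f (x / k))^`(n) = (fun x => k ^- n * (derive1n n f) (x / k)).
Proof.
move=> cf; elim: n => [|n IH]; first by apply/funext => x; rewrite invr1 mul1r.
rewrite derive1nS IH; apply: is_derive_derive1 => x.
have dF : is_derive (x / k) 1 (derive1n n f) ((derive1n n.+1 f) (x / k)).
  rewrite derive1nS derive1E; apply: derivableP.
  by apply: cinf_derivable; exact: cinf_derive1n.
have dk : is_derive x 1 (fun y : R => y / k) k^-1.
  rewrite (_ : (fun y => _) = (fun y => k^-1 * y + 0)); last first.
    by apply/funext => y; rewrite addr0 mulrC.
  exact: is_derive_affine.
have dC := @is_derive1_comp _ (derive1n n f) (fun y => y / k) x _ _ dF dk.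
have -> : (fun y : R => k ^- n * (derive1n n f) (y / k)) = k ^- n *: ((derive1n n f) \o (fun y => y / k)).
  by [].
apply: is_derive_eq; rewrite /GRing.scale/= exprS invfM; ring.
Qed.

Definition supp_in f (M : R) := forall x, M < `|x| -> f x = 0.

Lemma supp_in_derive1 f M : supp_in f M -> supp_in f^`() M.
Proof.
move=> fM x Mx; rewrite derive1E (@near_eq_derive _ _ _ _ (cst 0)).
  exact: derive_cst.
near=> z; rewrite fM//; near: z.
by apply: (@cvgr_norm_gt _ _ _ (nbhs x) _ id x _ M Mx); exact: cvg_id.
Unshelve. all: by end_near. Qed.

Lemma supp_in_derive1n n f M : supp_in f M -> supp_in f^`(n) M.
Proof. by move=> fM; elim: n => [//|n]; exact: supp_in_derive1. Qed.

Lemma continuous_supp_bounded f M : continuous f -> supp_in f M ->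
  exists2 C, 0 <= C & forall x, `|f x| <= C.
Proof.
move=> cf fM.
have [C [Cr HC]] : bounded_set (f @` `[- M, M]).
  apply: compact_bounded; apply: continuous_compact; last exact: segment_compact.
  exact: continuous_subspaceT.
exists (`|C| + 1) => [|x]; first by rewrite addr_ge0.
have [xM|Mx] := leP `|x| M; last by rewrite fM// normr0 addr_ge0.
apply: (HC (`|C| + 1)); first by rewrite (le_lt_trans (ler_norm _))// ltrDl.
by exists x => //=; rewrite in_itv/= -ler_norml.
Qed.

Notation mu := (@lebesgue_measure R).

Lemma continuous_supp_integrable f M : continuous f -> supp_in f M ->
  mu.-integrable setT (EFin \o f).
Proof.
move=> cf fM.
have fE : EFin \o f = (EFin \o f) \_ `[- M, M]%classic.
  apply/funext => x; rewrite patchE; case: ifPn => //.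
  rewrite notin_setE/= in_itv/= -ler_norml => /negP; rewrite -ltNge.
  by move=> /fM ->.
rewrite fE -integrable_mkcond//.
apply: continuous_compact_integrable; first exact: segment_compact.
exact: continuous_subspaceT.
Qed.

(** A compactly supported f has an antiderivative vanishing to the left of the
    support and equal to \int f to its right; it is compactly supported itself
    exactly when \int f = 0. *)
Lemma cinf_antiderivative f M : cinf f -> supp_in f M ->
  exists F : R -> R, [/\ cinf F, (forall x : R, is_derive x 1 F (f x)),
      forall x, x < - M -> F x = 0 &
      forall x, M <= x -> F x = (\int[mu]_t f t)%R].
Proof.
move=> cf fM; pose F x := (\int[mu]_(t in `]-oo, x]) f t)%R; exists F.
have dF (x : R) : is_derive x 1 F (f x).
  have fi : mu.-integrable `]-oo, (x + 1)%R] (EFin \o f).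
    apply: (integrableS measurableT) => //.
    exact: continuous_supp_integrable (cinf_continuous cf) fM.
  have xx1 : x < x + 1 by rewrite ltrDl.
  have [] := @continuous_FTC1 R f -oo%O x (x + 1) xx1 fi (ltNyr _)
    (@cinf_continuous f cf x).
  by move=> d1 d2; apply: DeriveDef => //; rewrite -derive1E.
split => //; first exact: cinf_primitive dF.
- move=> x xM; rewrite /F (@eq_Rintegral _ _ _ _ _ (cst 0)) ?Rintegral_cst ?mul0r//.
  move=> t; rewrite inE/= in_itv/= => tx; rewrite fM// ltr_normr.
  by rewrite orbC ltrNr (le_lt_trans tx).
- move=> x Mx; rewrite /F Rintegral_mkcond; congr (fine _).
  apply: eq_integral => t _; congr EFin; rewrite patchE; case: ifPn => //.
  rewrite notin_setE/= in_itv/= => /negP; rewrite -ltNge => xt.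
  by rewrite fM// (lt_le_trans _ (ler_norm _))// (le_lt_trans Mx).
Qed.

End one_variable.

(** * Bumps, plateaus and cutoffs on the line *)
Lemma Rintegral_dominated_cvg d (T : measurableType d) (R : realType)
    (mu : {measure set T -> \bar R}) (f_ : nat -> T -> R) (f g : T -> R) :
  (forall n, measurable_fun setT (f_ n)) ->
  (forall x, (fun n => f_ n x) @ \oo --> f x) ->
  mu.-integrable setT (EFin \o g) -> (forall n x, `|f_ n x| <= g x) ->
  (fun n => (\int[mu]_x f_ n x)%R) @ \oo --> (\int[mu]_x f x)%R.
Proof.
move=> mf_ f_f ig f_g.
have mf : measurable_fun setT f.
  by apply: (measurable_fun_cvg mf_) => x _; exact: f_f.
have mEf_ n : measurable_fun setT (EFin \o f_ n) by exact/measurable_EFinP.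
have mEf : measurable_fun setT (EFin \o f) by exact/measurable_EFinP.
have cf : {ae mu, forall x, setT x -> (EFin \o f_ n) x @[n --> \oo] --> (EFin \o f) x}.
  by apply: aeW => x _; apply: cvg_EFin; [exact: nearW|exact: f_f].
have lef : {ae mu, forall x n, setT x -> (`|(EFin \o f_ n) x| <= (EFin \o g) x)%E}.
  by apply: aeW => x n _; rewrite /= lee_fin.
have [intf _ cvgf] := dominated_convergence measurableT mEf_ mEf cf ig lef.
rewrite /Rintegral; apply: fine_cvg; rewrite fineK//.
exact: (integrable_fin_num measurableT intf).
Qed.

Section bumps.
Context {R : realType}.
Implicit Types (f g h : R -> R) (a b x : R).
Notation mu := (@lebesgue_measure R).

Lemma flat1_bounds x : 0 <= flat 1 x <= 1.
Proof.
rewrite /flat; case: ifPn => x0; last by rewrite lexx ler01.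
by rewrite hornerC mul1r expR_ge0 -expR0 ler_expR oppr_le0 invr_ge0 ltW.
Qed.

Lemma flat1_dilate_cvg x : 0 < x ->
  (fun n : nat => flat 1 (n%:R * x)) @ \oo --> (1 : R).
Proof.
move=> x0.
have inv0 : (fun n : nat => - (n%:R * x)^-1) @ \oo --> (0 : R).
  rewrite -oppr0; apply: cvgN.
  rewrite (_ : (fun _ => _) = (fun n : nat => n%:R^-1 * x^-1)); last first.
    by apply/funext => n; rewrite invfM.
  rewrite -(mul0r x^-1); apply: cvgMl.
  apply/gtr0_cvgV0; last exact: cvgr_idn.
  by near=> n; rewrite ltr0n; near: n; exists 1%N.
rewrite -[X in _ --> X](@expR0 R).
have E : (fun n : nat => expR (- (n%:R * x)^-1)) @ \oo --> expR (0 : R).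
  by apply: (cvg_comp _ _ inv0); exact: continuous_expR.
apply: cvg_trans E; apply: near_eq_cvg.
near=> n; rewrite /flat hornerC mul1r ifT// mulr_gt0// ltr0n.
by near: n; exists 1%N.
Unshelve. all: by end_near. Qed.

(** As n grows these increase to the indicator of the interval from a to b,
    since exp(-1/t) tends to 1 as t goes to infinity. *)
Definition pulse a b (n : nat) x :=
  flat 1 (n%:R * (x - a)) * flat 1 (n%:R * (b - x)).

Lemma cinf_pulse a b n : cinf (pulse a b n).
Proof.
rewrite (_ : pulse a b n = (fun x => flat 1 (n%:R * x + - (n%:R * a))) \*
    (fun x => flat 1 (- n%:R * x + n%:R * b))).
  by apply: cinf_mul; apply: cinf_affine; exact: cinf_flat.
apply/funext => x; rewrite /pulse /=; congr (flat _ _ * flat _ _); ring.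
Qed.

Lemma pulse_bounds a b n x : 0 <= pulse a b n x <= 1.
Proof.
rewrite /pulse.
have /andP[u0 u1] := flat1_bounds (n%:R * (x - a)).
have /andP[v0 v1] := flat1_bounds (n%:R * (b - x)).
by rewrite mulr_ge0//= mulr_ile1.
Qed.

Lemma pulse_out a b n x : ~~ (a < x < b) -> pulse a b n x = 0.
Proof.
rewrite negb_and -!leNgt /pulse => /orP[xa|bx].
  by rewrite flat_le0 ?mul0r// mulr_ge0_le0// subr_le0.
by rewrite [flat 1 (_ * (b - x))]flat_le0 ?mulr0// mulr_ge0_le0// subr_le0.
Qed.

Lemma pulse_cvg a b x :
  (fun n => pulse a b n x) @ \oo --> (\1_(`]a, b[) x : R).
Proof.
rewrite indicE; have [/andP[ax xb]|axb] := boolP (a < x < b).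
  rewrite mem_set; last by rewrite /= in_itv/= ax xb.
  rewrite -[X in _ --> X](mulr1 1); apply: cvgM;
    by apply: flat1_dilate_cvg; rewrite subr_gt0.
rewrite memNset; last by rewrite /= in_itv/=; exact/negP.
by under eq_fun do rewrite pulse_out//; exact: cvg_cst.
Qed.

Lemma pulse_supp a b n : supp_in (pulse a b n) (Num.max `|a| `|b|).
Proof.
move=> x; rewrite gt_max => /andP[ax bx]; apply: pulse_out.
apply/negP => /andP[xa xb].
move: ax bx; rewrite !lter_norml.
have := ler_norm b; have := lerNnormlW (lexx `|a|).
case: (leP 0 x) => x0.
  by rewrite (ger0_norm x0); lra.
by rewrite (ltr0_norm x0); lra.
Qed.

Lemma pulse_integral_cvg a b : a <= b ->
  (fun n => (\int[mu]_x pulse a b n x)%R) @ \oo --> b - a.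
Proof.
move=> ab.
have -> : b - a = (\int[mu]_x \1_(`]a, b[) x)%R.
  rewrite /Rintegral integral_indic// setIT [X in fine X]lebesgue_measure_itv/= lte_fin.
  case: ltP => [//|ba]; have /eqP -> : a == b by rewrite eq_le ab ba.
  by rewrite subrr.
apply: (@Rintegral_dominated_cvg _ (measurableTypeR R) R mu (pulse a b) (\1_(`]a, b[)) (\1_(`[a, b]))).
- by move=> n; apply: continuous_measurable_fun; exact/cinf_continuous/cinf_pulse.
- by move=> x; exact: pulse_cvg.
- exact: integrable_indic_itv.
- move=> n x; have /andP[p0 p1] := pulse_bounds a b n x.
  rewrite ger0_norm// indicE; have [xab|xab] := boolP (a < x < b).
    rewrite mem_set//= in_itv/=; move: xab => /andP[ax xb]; by rewrite !ltW.
  by rewrite pulse_out.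
Qed.

(** The pulses on the interval from -1 to 1 have integrals tending to 2, so one
    of them has a positive integral, by which it can be divided. *)
Lemma exists_unit_bump : exists rho : R -> R,
  [/\ cinf rho, supp_in rho 1 & (\int[mu]_x rho x)%R = 1].
Proof.
have c2 := @pulse_integral_cvg (-1) 1 (ltW (lt_trans (ltrN10 R) ltr01)).
have [n _ n0] : \forall n \near \oo, 0 < (\int[mu]_x pulse (-1) 1 n x)%R.
  by apply: (cvgr_gt _ c2); lra.
have {}n0 := n0 n (leqnn n).
set c := (\int[mu]_x _)%R in n0.
have ps : supp_in (pulse (-1) 1 n) 1.
  by move: (@pulse_supp (-1) 1 n); rewrite normrN normr1 maxxx.
exists (fun x => c^-1 * pulse (-1) 1 n x); split.
- apply: (@cinf_mul _ (cst c^-1)); [exact: cinf_cst|exact: cinf_pulse].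
- by move=> x x1; rewrite ps ?mulr0.
- rewrite RintegralZl// ?mulVf ?gt_eqF//.
  exact: (continuous_supp_integrable (cinf_continuous (cinf_pulse _ _ _)) ps).
Qed.

(** If H is an antiderivative of a unit bump, going from 0 to 1, then
    H(x + 2) H(2 - x) is 1 near 0 and 0 far from 0. *)
Lemma exists_plateau : exists h : R -> R,
  [/\ cinf h, supp_in h 3 & forall x, `|x| <= 1 -> h x = 1].
Proof.
have [rho [crho srho irho]] := exists_unit_bump.
have [H [cH _ H0 H1]] := cinf_antiderivative crho srho.
exists (fun x => H (1 * x + 2) * H (- 1 * x + 2)); split.
- apply: (@cinf_mul _ (fun x => H (1 * x + 2)) (fun x => H (- 1 * x + 2)));
  exact: cinf_affine.
- move=> x; rewrite ltNge ler_norml negb_and -!ltNge => /orP[x3|x3].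
    by rewrite H0 ?mul0r//; lra.
  by rewrite [H (-1 * x + 2)]H0 ?mulr0//; lra.
- move=> x; rewrite ler_norml => /andP[x1 x2].
  by rewrite !H1 ?irho ?mulr1//; lra.
Qed.

(** Each differentiation of h^(m+1) p costs one factor h:
    (h^(m+1) p)' = h^m ((m+1) h' p + h p'). *)
Lemma derive1n_pow_factor h : cinf h -> forall k n p, cinf p ->
  exists2 q, cinf q &
    derive1n k (fun x => h x ^+ (k + n) * p x) = fun x => h x ^+ n * q x.
Proof.
move=> ch; elim=> [|k IH] n p cp; first by exists p.
have [h' ch' hh'] := cinf_is_derive ch; have [p' cp' pp'] := cinf_is_derive cp.
pose q1 x := (k + n).+1%:R * h' x * p x + h x * p' x.
have cq1 : cinf q1.
  apply: (@cinf_add _ (fun x => (k + n).+1%:R * h' x * p x) (h \* p')).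
    apply: (@cinf_mul _ (fun x => (k + n).+1%:R * h' x)) => //.
    apply: (@cinf_mul _ (cst (k + n).+1%:R)) => //; exact: cinf_cst.
  exact: cinf_mul.
have [q cq qE] := IH n q1 cq1; exists q => //.
rewrite derive1Sn -qE; congr (derive1n k _).
apply: is_derive_derive1 => x.
have -> : (fun x => h x ^+ (k.+1 + n) * p x) = (h ^+ (k + n).+1) \* p.
  by apply/funext => y; rewrite addSn /= exprfctE.
apply: is_derive_eq.
rewrite /q1 /GRing.scale/= exprfctE exprS -mulr_natr; ring.
Qed.

(** The cutoff is h^6 with h a plateau function: for k <= 3 its k-th derivative
    is h^3 times a smooth factor, and (h^3)^2 = h^6.  The factor is bounded on
    the support of h. *)
Lemma exists_cutoff : exists f : R -> R, exists C,
  [/\ cinf f, supp_in f 3, forall x, 0 <= f x,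
      forall x, `|x| <= 1 -> f x = 1 &
      forall k x, (k <= 3)%N -> derive1n k f x ^+ 2 <= C * f x].
Proof.
have [h [ch hs h1]] := exists_plateau.
pose f x := h x ^+ 6.
have f0 x : 0 <= f x by rewrite /f (exprM _ 3 2) sqr_ge0.
have cf : cinf f.
  rewrite (_ : f = (h \* (h \* (h \* (h \* (h \* h)))))).
    by do 5 apply: cinf_mul => //.
  by apply/funext => x.
have bound (k : 'I_4) : exists C,
    0 <= C /\ forall x, derive1n k f x ^+ 2 <= C * f x.
  have c1 : cinf (cst 1 : R -> R) by exact: cinf_cst.
  have [q cq qE] := derive1n_pow_factor ch k (6 - k) c1.
  have k6 : (k + (6 - k) = 6)%N by rewrite subnKC// (leq_trans (ltnW (ltn_ord k))).
  have k3 : (k <= 3)%N by rewrite -ltnS.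
  have cr : cinf (fun x => h x ^+ (3 - k) * q x).
    have -> : (fun x => h x ^+ (3 - k) * q x) = (fun x => h x ^+ (3 - k)) \* q by [].
    apply: cinf_mul => //.
    elim: (3 - k)%N => [|m IH]; first exact: cinf_cst.
    by under eq_fun do rewrite exprS; exact: cinf_mul.
  have [C C0 HC] : exists2 C, 0 <= C & forall x, `|x| <= 3 ->
      `|h x ^+ (3 - k) * q x| <= C.
    have [C [_ HC]] : bounded_set ((fun x => h x ^+ (3 - k) * q x) @` `[- 3, 3]).
      apply: compact_bounded; apply: continuous_compact; last exact: segment_compact.
      apply: continuous_subspaceT; exact: cinf_continuous.
    exists (`|C| + 1) => [|x x3]; first by rewrite addr_ge0.
    apply: (HC (`|C| + 1)); first by rewrite (le_lt_trans (ler_norm _))// ltrDl.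
    by exists x => //=; rewrite in_itv/= -ler_norml.
  exists (C ^+ 2); split => [|x]; first exact: sqr_ge0.
  have -> : derive1n k f x = h x ^+ 3 * (h x ^+ (3 - k) * q x).
    have -> : f = (fun x => h x ^+ (k + (6 - k)) * cst 1 x).
      by apply/funext => y; rewrite k6 mulr1.
    rewrite qE mulrA -exprD; congr (_ ^+ _ * _).
    by rewrite addnBA.
  rewrite exprMn -exprM [leRHS]mulrC.
  have [x3|x3] := leP `|x| 3; last by rewrite /f hs// !expr0n/= !mul0r.
  rewrite ler_wpM2l ?(f0 x)//.
  by rewrite -real_normK ?num_real// lerXn2r ?nnegrE//; exact: HC.
have {bound} [C HC] := choice bound.
exists f, (\sum_(k < 4) C k); split => //.
- by move=> x x3; rewrite /f hs// expr0n.
- by move=> x x1; rewrite /f h1// expr1n.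
- move=> k x k3; have k4 : (k < 4)%N by [].
  apply: (le_trans ((HC (Ordinal k4)).2 x)).
  rewrite ler_wpM2r//.
  by rewrite (bigD1 (Ordinal k4))//= lerDl sumr_ge0// => i _; case: (HC i).
Qed.

End bumps.

(** * Products of functions of one coordinate as test functions *)
Section tensor.
Context {R : realType} {N : nat}.
Implicit Types (F : 'I_N -> R -> R) (x : 'rV[R]_N) (i j : 'I_N).
Notation leb := (@lebesgue_rV R N).

Definition tensor F x := \prod_(i < N) F i (x ord0 i).

Lemma tensor_bigD1 F i x :
  tensor F x = F i (x ord0 i) * \prod_(j < N | j != i) F j (x ord0 j).
Proof. by rewrite /tensor (bigD1 i). Qed.

Definition set_at i (f : R -> R) F : 'I_N -> R -> R :=
  fun j => if j == i then f else F j.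

Lemma tensor_set_at F i f x :
  tensor (set_at i f F) x =
  f (x ord0 i) * \prod_(j < N | j != i) F j (x ord0 j).
Proof.
rewrite (tensor_bigD1 _ i) /set_at eqxx; congr (_ * _).
by apply: eq_bigr => j /negbTE ->.
Qed.

Lemma is_derive_tensor F i x : (forall j, cinf (F j)) ->
  is_derive x (delta_mx ord0 i : 'rV[R]_N) (tensor F)
    (tensor (set_at i (derive1 (F i)) F) x).
Proof.
move=> cF; set c := \prod_(j < N | j != i) F j (x ord0 j).
have Fi : derivable (F i) (x ord0 i) 1 by exact: cinf_derivable.
have quot : (fun h : R => h^-1 *: ((tensor F \o shift x) (h *: (delta_mx ord0 i : 'rV[R]_N)) - tensor F x)) =
    (fun h : R => h^-1 *: ((F i \o shift (x ord0 i)) (h *: (1 : R)) - F i (x ord0 i)) * c).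
  apply/funext => h /=; rewrite !(tensor_bigD1 _ i) -/c !mxE !eqxx mulr1n.
  have -> : \prod_(j < N | j != i)
      F j ((h *: (delta_mx ord0 i : 'rV[R]_N) + x) ord0 j) = c.
    apply: eq_bigr => j /negbTE ji.
    by rewrite !mxE ji andbF mulr0n mulr0 add0r.
  by rewrite -mulrBl -scalerAl.
have cvgi : (fun h : R => h^-1 *: ((F i \o shift (x ord0 i)) (h *: (1 : R)) - F i (x ord0 i)) * c)
    @ 0^' --> derive1 (F i) (x ord0 i) * c.
  by apply: cvgMl; rewrite derive1E; exact: Fi.
rewrite tensor_set_at -/c; apply: DeriveDef.
  by apply/cvg_ex; exists (derive1 (F i) (x ord0 i) * c); rewrite quot.
by rewrite /derive quot; exact: (cvg_lim _ cvgi).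
Qed.

Lemma partial_tensor F i : (forall j, cinf (F j)) ->
  partial i (tensor F) = tensor (set_at i (derive1 (F i)) F).
Proof.
move=> cF; apply/funext => x; rewrite /partial.
by have /@derive_val := is_derive_tensor i x cF.
Qed.

Lemma partial_seq_tensor F (s : seq 'I_N) : (forall j, cinf (F j)) ->
  partial_seq s (tensor F) = tensor (fun j => derive1n (count_mem j s) (F j)).
Proof.
move=> cF; elim: s => [//|i s IH] /=.
rewrite IH partial_tensor => [|j]; last exact: cinf_derive1n.
congr tensor; apply/funext => j; rewrite /set_at [i == j]eq_sym.
by case: eqP => [->//|_]; rewrite add0n.
Qed.

Lemma continuous_tensor F : (forall j, cinf (F j)) -> continuous (tensor F).
Proof.
move=> cF; rewrite /tensor; elim: (index_enum _) => [|i r IH] x.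
  by under eq_fun do rewrite big_nil; exact: cst_continuous.
under eq_fun do rewrite big_cons.
apply: continuousM; last exact: IH.
apply: (continuous_comp (@coord_continuous _ _ _ ord0 i x)).
exact: cinf_continuous.
Qed.

Lemma measurable_tensor F : (forall j, cinf (F j)) ->
  measurable_fun setT (tensor F).
Proof.
move=> cF; apply: measurable_prod => i _.
apply: measurableT_comp; last exact: measurable_coord.
exact: (continuous_measurable_fun (cinf_continuous (cF i))).
Qed.

Definition box (r : R) : set 'rV[R]_N := [set x | forall i, `|x ord0 i| <= r].

Lemma box_itv r : box r = [set x | forall i, `[- r, r]%classic (x ord0 i)].
Proof.
by apply/seteqP; split => x xr i /=; have := xr i; rewrite /= in_itv/= ler_norml.
Qed.

Lemma box_compact r : compact (box r).
Proof.
rewrite box_itv.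
exact: (@rV_compact R N (fun=> `[- r, r]%classic) (fun=> @segment_compact _ _ _)).
Qed.

Lemma rV_box_measurable (A : 'I_N -> set R) : (forall i, measurable (A i)) ->
  measurable [set x : 'rV[R]_N | forall i, A i (x ord0 i)].
Proof.
move=> mA; rewrite (_ : mkset _ =
   \big[setI/setT]_(i < N) ((fun x : 'rV[R]_N => x ord0 i) @^-1` A i)).
  apply: bigsetI_measurable => i _.
  by rewrite -[X in measurable X]setTI; exact: measurable_coord.
rewrite -bigcap_seq; apply/seteqP; split=> x /= Ax i; first by move=> _.
by apply: Ax; rewrite /= mem_index_enum.
Qed.

Lemma box_measurable r : measurable (box r).
Proof. by rewrite box_itv; exact: (@rV_box_measurable (fun=> `[- r, r]%classic)). Qed.

Lemma leb_box r : 0 <= r -> leb (box r) = ((2 * r) ^+ N)%:E.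
Proof.
move=> r0; rewrite box_itv (@lebesgue_rV_box R N (fun=> `[- r, r]%classic))//.
rewrite (eq_bigr (fun => (2 * r)%:E)) => [|i _].
  by rewrite prodEFin prodr_const card_ord.
rewrite lebesgue_measure_itv/= lte_fin; case: ltP => H; first by congr EFin; ring.
by congr EFin; lra.
Qed.

Lemma test_function_tensor F M : (forall j, cinf (F j)) ->
  (forall j, supp_in (F j) M) -> test_function (tensor F).
Proof.
move=> cF sF; split.
  move=> s; rewrite partial_seq_tensor//; split.
    by apply: continuous_tensor => j; exact: cinf_derive1n.
  move=> i x; have [] // := is_derive_tensor i x (fun j => cinf_derive1n (count_mem j s) (cF j)).
apply: (subclosed_compact (@closed_closure _ _) (@box_compact M)).
have cb : closed (box M).
  by apply: compact_closed; [exact: norm_hausdorff|exact: box_compact].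
rewrite ((closure_id _).1 cb); apply: closure_subset => x /= + i.
apply: contra_neqT; rewrite -ltNge => xM.
by rewrite (tensor_bigD1 _ i) sF ?mul0r.
Qed.

End tensor.

(** * The energy identity and the derivatives of the cutoff *)
Section local_integrability.
Context {R : realType} {N : nat}.
Implicit Types (F : 'I_N -> R -> R) (x : 'rV[R]_N) (i j : 'I_N).
Notation leb := (@lebesgue_rV R N).

Lemma tensor_bounded F M : (forall j, cinf (F j)) -> (forall j, supp_in (F j) M) ->
  exists C, forall x, `|tensor F x| <= C.
Proof.
move=> cF sF.
have b j : exists C, 0 <= C /\ forall t, `|F j t| <= C.
  have [C C0 HC] := continuous_supp_bounded (cinf_continuous (cF j)) (sF j).
  by exists C.
have {b} [C HC] := choice b.
exists (\prod_(j < N) C j) => x; rewrite normr_prod; apply: ler_prod => j _.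
by rewrite normr_ge0 (HC j).2.
Qed.

Lemma tensor_out F M x : (forall j, supp_in (F j) M) -> ~ box M x ->
  tensor F x = 0.
Proof.
move=> sF; apply: contra_notP => /eqP tx i; rewrite leNgt; apply/negP => Mx.
by move: tx; rewrite (tensor_bigD1 _ i) sF// mul0r eqxx.
Qed.

Lemma Lp_loc1_integrable_box (g : 'rV[R]_N -> R) M : Lp_loc 1 g ->
  leb.-integrable (box M) (EFin \o g).
Proof.
move=> [mg ig]; apply/integrableP; split.
  by apply/measurable_EFinP; exact: measurable_funTS.
by have := ig _ (@box_compact R N M); under eq_integral do rewrite expr1.
Qed.

Lemma integrable_mul_bounded (g z : 'rV[R]_N -> R) M C : Lp_loc 1 g ->
  measurable_fun setT z -> (forall x, `|z x| <= C) ->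
  (forall x, ~ box M x -> z x = 0) ->
  leb.-integrable setT (EFin \o (fun x => g x * z x)).
Proof.
move=> Lg mz zC z0; have [mg _] := Lg.
have -> : EFin \o (fun x => g x * z x) =
    (EFin \o (fun x => g x * z x)) \_ (box M).
  apply/funext => x; rewrite patchE; case: ifPn => //.
  by rewrite notin_setE => /z0 /= ->; rewrite mulr0.
rewrite -integrable_mkcond; last exact: box_measurable.
apply: (@le_integrable _ _ _ _ _ (box_measurable M) _
  (EFin \o (fun x => C * g x))).
- by apply/measurable_EFinP; apply: measurable_funTS; exact: measurable_funM.
- move=> x _ /=; rewrite lee_fin !normrM mulrC ler_wpM2r//.
  exact: le_trans (zC x) (ler_norm _).
- rewrite (_ : _ \o _ = (fun x => C%:E * (EFin \o g) x)%E); last first.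
    by apply/funext => x /=.
  by apply: integrableZl; [exact: box_measurable|exact: Lp_loc1_integrable_box].
Qed.

Lemma integrable_mul_tensor (g : 'rV[R]_N -> R) F M : Lp_loc 1 g ->
  (forall j, cinf (F j)) -> (forall j, supp_in (F j) M) ->
  leb.-integrable setT (EFin \o (fun x => g x * tensor F x)).
Proof.
move=> Lg cF sF; have [C HC] := tensor_bounded cF sF.
apply: (@integrable_mul_bounded _ _ M C) => //; first exact: measurable_tensor.
by move=> x; exact: tensor_out.
Qed.

End local_integrability.

Section energy.
Context {R : realType} {N : nat}.
Implicit Types (F : 'I_N -> R -> R) (x : 'rV[R]_N) (i j : 'I_N).
Notation leb := (@lebesgue_rV R N).

(** In each term one derivative falls on phi through the definition of its weak
    gradient and the others stay on the test function, so that no smoothness of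
    phi beyond its weak gradient is involved. *)
Lemma energy_identity (phi : 'rV[R]_N -> R) (g : 'I_N -> 'rV[R]_N -> R) F M :
  weak_gradient phi g ->
  (forall eta, test_function eta ->
    distr_laplacian (distr_laplacian (distr_of phi)) eta
    + distr_laplacian (distr_of phi) eta
    + 2^-1 * distr_of (sqnorm g) eta = 0) ->
  (forall j, cinf (F j)) -> (forall j, supp_in (F j) M) ->
  2^-1 * distr_of (sqnorm g) (tensor F) =
  \sum_(i < N) \sum_(j < N) distr_of (g j) (partial_seq [:: j; i; i] (tensor F))
  + \sum_(i < N) distr_of (g i) (partial_seq [:: i] (tensor F)).
Proof.
move=> [_ _ wg] sol cF sF.
have tF s : test_function (partial_seq s (tensor F)).
  rewrite partial_seq_tensor//; apply: (@test_function_tensor _ _ _ M) => j.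
    exact: cinf_derive1n.
  exact: supp_in_derive1n.
have lapE s : distr_laplacian (distr_of phi) (partial_seq s (tensor F)) =
    - \sum_(j < N) distr_of (g j) (partial_seq (j :: s) (tensor F)).
  rewrite /distr_laplacian -sumrN; apply: eq_bigr => j _.
  by rewrite -(wg j _ (tF (j :: s))).
have := sol _ (tF [::]).
have -> : distr_laplacian (distr_laplacian (distr_of phi))
    (partial_seq [::] (tensor F)) =
    - \sum_(i < N) \sum_(j < N) distr_of (g j) (partial_seq [:: j; i; i] (tensor F)).
  rewrite {1}/distr_laplacian -sumrN; apply: eq_bigr => i _.
  by rewrite -(lapE [:: i; i]) /distr_partial opprK.
rewrite lapE => /eqP; rewrite addrC addr_eq0 => /eqP ->.
by rewrite opprD !opprK.
Qed.

Lemma sum_count_mem (s : seq 'I_N) : (\sum_(j < N) count_mem j s = size s)%N.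
Proof.
elim: s => [|i s IH]; first by rewrite big1.
rewrite /= big_split/= IH (bigD1 i)//= eqxx big1 ?addn0// => j.
by rewrite eq_sym => /negbTE ->.
Qed.

Definition dilate (f : R -> R) (r : R) : 'I_N -> R -> R := fun _ t => f (t / r).

Lemma cinf_dilate f r j : cinf f -> cinf (dilate f r j).
Proof. exact: cinf_scale. Qed.

Lemma supp_in_dilate f M r j : 0 < r -> supp_in f M ->
  supp_in (dilate f r j) (M * r).
Proof.
move=> r0 fM x Mx; rewrite /dilate fM// normrM normfV (gtr0_norm r0).
by rewrite ltr_pdivlMr.
Qed.

Lemma partial_seq_dilate f r s x : cinf f ->
  partial_seq s (tensor (dilate f r)) x =
  r ^- size s * \prod_(j < N) derive1n (count_mem j s) f (x ord0 j / r).
Proof.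
move=> cf; rewrite partial_seq_tensor => [|j]; last exact: cinf_dilate.
rewrite /tensor -sum_count_mem -exprVn -prodrXr -big_split/=.
by apply: eq_bigr => j _; rewrite /dilate derive1n_scale// exprVn.
Qed.

(** The bound on the profile is applied in each coordinate; of the factor
    r^(- 2 size s) produced by the dilation only r^(-2) is kept, the price of
    treating the orders 1 and 3 alike. *)
Lemma partial_seq_dilate_sqr f r s x C : cinf f -> 1 <= r ->
  (0 < size s <= 3)%N -> (forall t, 0 <= f t) ->
  (forall k t, (k <= 3)%N -> derive1n k f t ^+ 2 <= C * f t) ->
  partial_seq s (tensor (dilate f r)) x ^+ 2 <=
    C ^+ N / r ^+ 2 * tensor (dilate f r) x.
Proof.
move=> cf r1 /andP[s0 s3] f0 fC.
have r0 : 0 < r by exact: lt_le_trans r1.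
rewrite partial_seq_dilate// exprMn -[leRHS]mulrAC [leLHS]mulrC -prodrXl.
have -> : C ^+ N * tensor (dilate f r) x = \prod_(j < N) (C * f (x ord0 j / r)).
  by rewrite big_split/= prodr_const card_ord.
apply: ler_pM.
- by apply: prodr_ge0 => j _; exact: sqr_ge0.
- exact: sqr_ge0.
- apply: ler_prod => j _; rewrite sqr_ge0/=; apply: fC.
  exact: leq_trans (count_size _ _) s3.
- rewrite exprVn -exprM lef_pV2 ?posrE ?exprn_gt0//.
  by rewrite ler_weXn2l// leq_pmull.
Qed.

Lemma derive1n_plateau (f : R -> R) k t : (forall u, `|u| <= 1 -> f u = 1) ->
  (0 < k)%N -> `|t| < 1 -> derive1n k f t = 0.
Proof.
move=> f1; case: k => // k _; elim: k t => [|k IH] t t1.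
  rewrite derive1n1 derive1E (@near_eq_derive _ R R _ (cst 1)).
    exact: derive_cst.
  near=> z; apply: f1; apply: ltW; near: z.
  by apply: (@cvgr_norm_lt _ _ _ (nbhs t) _ id t _ 1 t1); exact: cvg_id.
rewrite derive1nS derive1E (@near_eq_derive _ _ _ _ (cst 0)).
  exact: derive_cst.
near=> z; apply: IH; near: z.
by apply: (@cvgr_norm_lt _ _ _ (nbhs t) _ id t _ 1 t1); exact: cvg_id.
Unshelve. all: by end_near. Qed.

Lemma partial_seq_dilate_in f r i s x : cinf f -> 0 < r ->
  (forall t, `|t| <= 1 -> f t = 1) -> box r x ->
  partial_seq (i :: s) (tensor (dilate f (2 * r))) x = 0.
Proof.
move=> cf r0 f1 xr; rewrite partial_seq_dilate// (bigD1 i)//=.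
rewrite (derive1n_plateau f1) ?mul0r ?mulr0//; first by rewrite eqxx.
rewrite normrM normfV (@gtr0_norm _ (2 * r)) ?mulr_gt0//.
rewrite ltr_pdivrMr ?mulr_gt0// mul1r (le_lt_trans (xr i))//.
by rewrite ltr_pMl// ltr1n.
Qed.

(** Young's inequality in the form in which it is applied with z = g_j times a
    derivative of the cutoff, X = q eta and Y = C / r^2: no division by eta is
    involved. *)
Lemma young_sqr (a X Y z : R) : 0 < a -> 0 <= X -> 0 <= Y -> z ^+ 2 <= X * Y ->
  `|z| <= a * X + Y / (4 * a).
Proof.
move=> a0 X0 Y0 zXY.
have b0 : 0 <= a * X + Y / (4 * a) by rewrite addr_ge0// ?mulr_ge0 ?invr_ge0// ?mulr_ge0 ?ltW.
rewrite -(@ler_pXn2r _ 2) ?nnegrE// real_normK ?num_real//.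
apply: (le_trans zXY).
have -> : (a * X + Y / (4 * a)) ^+ 2 = X * Y + (a * X - Y / (4 * a)) ^+ 2.
  by field; rewrite gt_eqF.
by rewrite lerDl sqr_ge0.
Qed.

End energy.

(** * The energy estimate *)
Section energy_estimate.
Context {R : realType} {N : nat}.
Implicit Types (x : 'rV[R]_N) (i j : 'I_N).
Notation leb := (@lebesgue_rV R N).

Definition annulus (r : R) : set 'rV[R]_N := box (6 * r) `\` box r.

Lemma annulus_measurable r : measurable (annulus r).
Proof. by apply: measurableD; exact: box_measurable. Qed.

Lemma leb_annulus r : (N <= 2)%N -> 1 <= r ->
  (leb (annulus r) <= (144 * r ^+ 2)%:E)%E.
Proof.
move=> N2 r1; have r0 : 0 <= r by exact: le_trans r1.
apply: (@le_trans _ _ (leb (box (6 * r)))).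
  apply: (le_measure _ (mem_set (annulus_measurable r))
    (mem_set (@box_measurable _ _ (6 * r)))).
  by move=> x [].
rewrite leb_box ?mulr_ge0// lee_fin.
have -> : 144 * r ^+ 2 = (2 * (6 * r)) ^+ 2 by ring.
by rewrite ler_weXn2l//; lra.
Qed.

Variables (f : R -> R) (C : R).
Hypotheses (cf : cinf f) (sf : supp_in f 3) (f0 : forall t, 0 <= f t)
  (f1 : forall t, `|t| <= 1 -> f t = 1)
  (fC : forall k t, (k <= 3)%N -> derive1n k f t ^+ 2 <= C * f t).
Variable g : 'I_N -> 'rV[R]_N -> R.
Hypotheses (Lg : forall i, Lp_loc 1 (g i)) (Lq : Lp_loc 1 (sqnorm g)).

Let eta r : 'rV[R]_N -> R := tensor (dilate f (2 * r)).

Lemma cutoff_const_ge1 : 1 <= C.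
Proof.
have := @fC 0%N 0 isT.
by rewrite derive1n0 f1 ?normr0// expr1n mulr1.
Qed.

Let f_le_C t : f t <= C.
Proof.
have := @fC 0%N t isT; rewrite derive1n0 expr2.
have [->|ft0] := eqVneq (f t) 0; first by rewrite (le_trans ler01 cutoff_const_ge1).
by rewrite ler_pM2r// lt0r ft0 f0.
Qed.

Lemma eta_ge0 r x : 0 <= eta r x.
Proof. by apply: prodr_ge0 => j _; exact: f0. Qed.

Lemma eta_le r x : eta r x <= C ^+ N.
Proof.
have -> : C ^+ N = \prod_(j < N) C by rewrite prodr_const card_ord.
by apply: ler_prod => j _; rewrite f0 f_le_C.
Qed.

Lemma eta_box r x : 0 < r -> box r x -> eta r x = 1.
Proof.
move=> r0 xr; rewrite /eta /tensor big1// => j _; rewrite /dilate f1//.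
rewrite normrM normfV (@gtr0_norm _ (2 * r)) ?mulr_gt0//.
rewrite ler_pdivrMr ?mulr_gt0// mul1r (le_trans (xr j))//.
by rewrite ler_peMl// ?ltW// ltr1n.
Qed.

Lemma sqnorm_ge0 x : 0 <= sqnorm g x.
Proof. by apply: sumr_ge0 => i _; exact: sqr_ge0. Qed.

Lemma sqr_le_sqnorm j x : g j x ^+ 2 <= sqnorm g x.
Proof.
rewrite /sqnorm (bigD1 j)//= lerDl sumr_ge0// => i _; exact: sqr_ge0.
Qed.

Lemma sqnorm_eta_integrable r : 0 < r ->
  leb.-integrable setT (EFin \o (fun x => sqnorm g x * eta r x)).
Proof.
move=> r0; apply: (@integrable_mul_tensor _ _ _ _ (3 * (2 * r))) => // j.
  exact: cinf_dilate.
by apply: supp_in_dilate => //; rewrite mulr_gt0.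
Qed.

(** The first term comes from q eta, the second from the volume of the annulus:
    the r^2 of the volume cancels the r^(-2) of the bound on the derivatives. *)
Lemma energy_term r a i s j : (N <= 2)%N -> 1 <= r -> 0 < a ->
  (size s < 3)%N ->
  `| distr_of (g j) (partial_seq (i :: s) (eta r)) | <=
    a * (\int[leb]_(x in annulus r) (sqnorm g x * eta r x))%R + 9 * C ^+ N / a.
Proof.
have C1 := cutoff_const_ge1.
move=> N2 r1 a0 s3; have r0 : 0 < r by exact: lt_le_trans r1.
set z := partial_seq _ _.
have r20 : 0 < 2 * r by rewrite mulr_gt0.
have zE : z = tensor (fun k => derive1n (count_mem k (i :: s)) (dilate f (2 * r) k)).
  by rewrite /z /eta partial_seq_tensor// => k; exact: cinf_dilate.
have cF k : cinf (derive1n (count_mem k (i :: s)) (dilate f (2 * r) k)).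
  by apply: cinf_derive1n; exact: cinf_dilate.
have sF k : supp_in (derive1n (count_mem k (i :: s)) (dilate f (2 * r) k)) (6 * r).
  apply: supp_in_derive1n; rewrite (_ : 6 * r = 3 * (2 * r)); last by ring.
  exact: supp_in_dilate.
have gz_int : leb.-integrable setT (EFin \o (fun x => g j x * z x)).
  by rewrite zE; apply: integrable_mul_tensor cF sF.
set q := fun x => sqnorm g x * eta r x.
pose c := C ^+ N / (2 * r) ^+ 2 / (4 * a).
have c0 : 0 <= c.
  by rewrite !mulr_ge0// ?invr_ge0 ?exprn_ge0 ?mulr_ge0 ?ltW// (lt_le_trans ltr01).
have q_int : leb.-integrable (annulus r) (EFin \o q).
  apply: integrableS (sqnorm_eta_integrable r0) => //; exact: annulus_measurable.
have vol := leb_annulus N2 r1.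
have vol_fin : (leb (annulus r) < +oo)%E by rewrite (le_lt_trans vol)// ltry.
have c_int : leb.-integrable (annulus r) (EFin \o cst c).
  apply: measurable_bounded_integrable => //; first exact: annulus_measurable.
  exact: bounded_cst.
have aq_int : leb.-integrable (annulus r) (EFin \o (fun x => a * q x)).
  rewrite (_ : _ \o _ = (fun x => a%:E * (EFin \o q) x)%E); last first.
    by apply/funext => x /=.
  by apply: integrableZl => //; exact: annulus_measurable.
pose w := (fun x => a * q x + c) \_ (annulus r).
have w_int : leb.-integrable setT (EFin \o w).
  rewrite /w -restrict_EFin -integrable_mkcond; last exact: annulus_measurable.
  exact: (integrableD (annulus_measurable r) aq_int c_int).
have gzw x : `|g j x * z x| <= w x.
{ rewrite /w patchE; case: ifPn => [_|].
  - apply: young_sqr => //.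
    + by rewrite mulr_ge0 ?sqnorm_ge0 ?eta_ge0.
    + by rewrite mulr_ge0// ?invr_ge0 ?exprn_ge0 ?ltW// (lt_le_trans ltr01).
    + rewrite exprMn /q -mulrA; apply: ler_pM; rewrite ?sqr_ge0 ?sqr_le_sqnorm//.
      rewrite mulrC; apply: partial_seq_dilate_sqr => //; lra.
  - rewrite notin_setE /annulus => /not_andP[xr|/contrapT xr].
      by rewrite zE (tensor_out sF xr) mulr0 normr0.
    by rewrite /z partial_seq_dilate_in// mulr0 normr0. }
rewrite /distr_of; apply: (le_trans (le_normr_Rintegral measurableT gz_int)).
apply: (@le_trans _ _ (\int[leb]_x w x)%R).
  apply: le_Rintegral => //.
  by have := integrable_norm gz_int.
rewrite -Rintegral_mkcond RintegralD//; last exact: annulus_measurable.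
rewrite RintegralZl//; last exact: annulus_measurable.
rewrite lerD2l Rintegral_cst; last exact: annulus_measurable.
apply: (@le_trans _ _ (c * (144 * r ^+ 2))).
  apply: ler_wpM2l => //; rewrite -lee_fin fineK//.
  by rewrite ge0_fin_numE.
rewrite /c le_eqVlt; apply/orP; left; apply/eqP.
by field; rewrite !gt_eqF.
Qed.

Definition energy_in (r : R) := (\int[leb]_(x in box r) sqnorm g x)%R.

Lemma energy_in_ge0 r : 0 <= energy_in r.
Proof. by apply: Rintegral_ge0 => x _; exact: sqnorm_ge0. Qed.

Lemma annulus_energy r : 0 < r ->
  (\int[leb]_(x in annulus r) (sqnorm g x * eta r x))%R <=
  C ^+ N * (energy_in (6 * r) - energy_in r).
Proof.
have C1 := cutoff_const_ge1.
move=> r0.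
have mA := annulus_measurable r.
have q_int : leb.-integrable (annulus r) (EFin \o sqnorm g).
  apply: integrableS (Lp_loc1_integrable_box (6 * r) Lq) => //.
    exact: box_measurable.
  by move=> x [].
have CN0 : 0 <= C ^+ N by rewrite exprn_ge0// (le_trans ler01).
have -> : energy_in (6 * r) - energy_in r =
    (\int[leb]_(x in annulus r) sqnorm g x)%R.
{ have boxE : box (6 * r) = box r `|` annulus r.
    rewrite /annulus setDUK// => x xr i.
    by rewrite (le_trans (xr i))// ler_peMl// ?ltW// ltr1n.
  rewrite /energy_in boxE Rintegral_setU//.
  - by rewrite addrC addKr.
  - exact: box_measurable.
  - by rewrite -boxE; exact: Lp_loc1_integrable_box.
  - by apply/disj_setPS => x [xr []]. }
rewrite -RintegralZl//; apply: le_Rintegral => //.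
- by apply: integrableS (sqnorm_eta_integrable r0).
- rewrite (_ : _ \o _ = (fun x => (C ^+ N)%:E * (EFin \o sqnorm g) x)%E).
    exact: integrableZl.
  by apply/funext => x /=.
- by move=> x _; rewrite mulrC ler_wpM2r ?sqnorm_ge0 ?eta_le.
Qed.

End energy_estimate.

Lemma le_Rintegral_subset d (T : measurableType d) (R : realType)
    (mu : {measure set T -> \bar R}) (A : set T) (h k : T -> R) :
  measurable A -> mu.-integrable A (EFin \o h) -> mu.-integrable setT (EFin \o k) ->
  (forall x, A x -> h x <= k x) -> (forall x, 0 <= k x) ->
  (\int[mu]_(x in A) h x <= \int[mu]_x k x)%R.
Proof.
move=> mA ih ik hk k0; rewrite Rintegral_mkcond; apply: le_Rintegral => //.
  by rewrite -restrict_EFin -integrable_mkcond.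
move=> x _; rewrite patchE; case: ifPn => [/set_mem|_]; [exact: hk|exact: k0].
Qed.

(** I is the energy in a cube, E the energy weighted by the cutoff and J the
    part of E in the annulus.  With a = 1/(2K) the term a J is absorbed by E,
    so I is bounded; being nondecreasing along 6^k, it converges, and so
    I(6r) - I(r) tends to 0 there.  The limit l then satisfies l <= K/a for
    all a. *)
Lemma hole_filling_vanishes (R : realType) (I : R -> R) (K D : R) :
  0 < K -> (forall r, 1 <= r -> 0 <= I r) ->
  (forall r, 1 <= r -> I r <= I (6 * r)) ->
  (forall r, 1 <= r -> exists E J : R,
    [/\ I r <= E, J <= E, J <= D * (I (6 * r) - I r) &
        forall a, 0 < a -> E <= K * (a * J + a^-1)]) ->
  forall k, I (6 ^+ k) = 0.
Proof.
move=> K0 I0 Imono H; have r1 k : 1 <= 6 ^+ k :> R by rewrite exprn_ege1// ler1n.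
pose u k := I (6 ^+ k).
have uS k : u k <= u k.+1 by rewrite /u exprS; exact: Imono.
have ubd k : u k <= 4 * K ^+ 2.
  have [E [J [IE JE _ EJ]]] := H _ (r1 k).
  have a0 : 0 < (2 * K)^-1 by rewrite invr_gt0 mulr_gt0.
  apply: (le_trans IE); have := EJ _ a0; rewrite invrK.
  have -> : K * ((2 * K)^-1 * J + 2 * K) = J / 2 + 2 * K ^+ 2.
    by field; rewrite gt_eqF.
  by move: JE; lra.
have ndu : nondecreasing_seq u by apply/nondecreasing_seqP.
have cu : cvgn u.
  apply: nondecreasing_is_cvgn => //; exists (4 * K ^+ 2) => _ [k _ <-]//.
set l := limn u in cu *.
have ul k : u k <= l by apply: nondecreasing_cvgn_le.
suff l0 : l <= 0.
  by move=> k; apply: le_anti; rewrite I0// andbT (le_trans (ul k)).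
have lKa a : 0 < a -> l <= K / a.
  move=> a0.
  have cv : (fun k => K * (a * (D * (u k.+1 - u k)) + a^-1)) @ \oo --> K * (a * (D * (l - l)) + a^-1).
    apply: cvgMr; apply: cvgD; last exact: cvg_cst.
    apply: cvgMr; apply: cvgMr; apply: cvgB => //.
    by rewrite cvg_shiftS.
  rewrite subrr !mulr0 add0r in cv.
  apply: (ler_cvg_to cu cv); apply: nearW => k.
  have [E [J [IE _ JI EJ]]] := H _ (r1 k).
  apply: (le_trans IE); apply: (le_trans (EJ a a0)).
  apply: ler_wpM2l; first exact: ltW.
  rewrite lerD2r; apply: ler_wpM2l; first exact: ltW.
  by rewrite /u exprS.
(* Here a = 2K/l would give l <= l/2. *)
rewrite leNgt; apply/negP => l0.
have := lKa (2 * K / l) (divr_gt0 (mulr_gt0 (ltr0n _ 2) K0) l0).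
have -> : K / (2 * K / l) = l / 2 by field; rewrite !gt_eqF.
lra.
Qed.

Section vanishing_energy.
Context {R : realType} {N : nat}.
Implicit Types (x : 'rV[R]_N) (i j : 'I_N).
Notation leb := (@lebesgue_rV R N).
Variables (phi : 'rV[R]_N -> R) (g : 'I_N -> 'rV[R]_N -> R).
Hypotheses (N2 : (N <= 2)%N) (wg : weak_gradient phi g) (Lq : Lp_loc 1 (sqnorm g)).
Hypothesis sol : forall eta, test_function eta ->
    distr_laplacian (distr_laplacian (distr_of phi)) eta
    + distr_laplacian (distr_of phi) eta
    + 2^-1 * distr_of (sqnorm g) eta = 0.

Lemma energy_vanishes k : energy_in g (6 ^+ k) = 0.
Proof.
have [f [C [cf sf f0 f1 fC]]] := @exists_cutoff R.
have [_ Lg _] := wg.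
have C1 := cutoff_const_ge1 f1 fC.
have CN0 : 0 < C ^+ N by rewrite exprn_gt0// (lt_le_trans ltr01).
pose eta r : 'rV[R]_N -> R := tensor (dilate f (2 * r)).
pose E r := distr_of (sqnorm g) (eta r).
pose J r := (\int[leb]_(x in annulus r) (sqnorm g x * eta r x))%R.
have qe0 r x : 0 <= sqnorm g x * eta r x.
  by rewrite mulr_ge0 ?sqnorm_ge0// eta_ge0.
have qi r : 0 < r -> leb.-integrable setT (EFin \o (fun x => sqnorm g x * eta r x)).
  by move=> r0; apply: sqnorm_eta_integrable.
have J0 r : 0 <= J r by apply: Rintegral_ge0 => x _.
(* There are N^2 + N <= 6 terms, each at most a J + 9 C^N / a; the factor 1/2
   in the equation doubles this, and 108 = 2 * 6 * 9 dominates both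
   coefficients since 1 <= C. *)
apply: (@hole_filling_vanishes R (energy_in g) (108 * C ^+ N) (C ^+ N)).
- by rewrite mulr_gt0.
- by move=> r _; exact: energy_in_ge0.
- move=> r r1; have r0 : 0 < r by exact: lt_le_trans r1.
  have := annulus_energy cf sf f0 f1 fC Lq r0.
  by move/(le_trans (J0 r)); rewrite pmulr_rge0// subr_ge0.
- move=> r r1; have r0 : 0 < r by exact: lt_le_trans r1.
  exists (E r), (J r); split.
  + apply: le_Rintegral_subset => //; [exact: box_measurable| |exact: qi|].
      exact: Lp_loc1_integrable_box.
    by move=> x xr; rewrite /eta eta_box// mulr1.
  + apply: le_Rintegral_subset => //; [exact: annulus_measurable| |exact: qi].
    by apply: integrableS (qi r r0) => //; exact: annulus_measurable.
  + exact: annulus_energy.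
  + move=> a a0; set b := a * J r + 9 * C ^+ N / a.
    have b0 : 0 <= b.
      by rewrite addr_ge0// ?mulr_ge0// ?invr_ge0 ?ltW// mulr_gt0.
    have term s i j : (size s < 3)%N -> distr_of (g j) (partial_seq (i :: s) (eta r)) <= b.
      by move=> s3; apply: le_trans (ler_norm _) _; apply: energy_term.
    have EE : 2^-1 * E r <= 6 * b.
      have cF (j : 'I_N) : cinf (dilate f (2 * r) j) by exact: cinf_dilate.
      have sF (j : 'I_N) : supp_in (dilate f (2 * r) j) (3 * (2 * r)).
        by apply: supp_in_dilate => //; rewrite mulr_gt0.
      rewrite /E (energy_identity wg sol cF sF).
      apply: (@le_trans _ _ (\sum_(i < N) \sum_(j < N) b + \sum_(i < N) b)).
        apply: lerD; last by apply: ler_sum => i _; exact: term.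
        by apply: ler_sum => i _; apply: ler_sum => j _; exact: term.
      rewrite !sumr_const !card_ord -mulrnA -mulrnDr -[leLHS]mulr_natl.
      apply: ler_wpM2r => //; rewrite ler_nat.
      by case: (N) N2 => [|[|[|]]].
    have -> : 108 * C ^+ N * (a * J r + a^-1) = 108 * C ^+ N * a * J r + 108 * C ^+ N / a.
      by rewrite mulrDr !mulrA.
    have : 12 * (a * J r) <= 108 * C ^+ N * a * J r.
      have -> : 108 * C ^+ N * a * J r = 12 * (9 * C ^+ N * (a * J r)) by ring.
      rewrite ler_pM2l// ler_peMl ?mulr_ge0 ?(ltW a0)//.
      have := exprn_ege1 N C1; lra.
    have -> : 108 * C ^+ N / a = 12 * (9 * C ^+ N / a) by ring.
    move: EE; rewrite /b; lra.
Qed.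

Lemma bigcup_box : \bigcup_k (@box R N (6 ^+ k)) = setT.
Proof.
apply/seteqP; split => // x _.
pose M := \sum_(i < N) `|x ord0 i|.
have [k Mk] : exists k, M <= 6 ^+ k.
  exists (Num.truncn M).+1; apply: (@le_trans _ _ (Num.truncn M).+1%:R).
    by rewrite ltW// truncnS_gt.
  by rewrite -natrX ler_nat ltnW// ltn_expl.
exists k => // i; apply: le_trans Mk.
by rewrite /M (bigD1 i)//= lerDl sumr_ge0.
Qed.

Lemma sqnorm_ae0 : {ae leb, forall x, sqnorm g x = 0}.
Proof.
have H k : {ae leb, forall x, box (6 ^+ k) x -> sqnorm g x = 0}.
  have iq := Lp_loc1_integrable_box (6 ^+ k) Lq.
  have /integrableP[mq _] := iq.
  have : (\int[leb]_(x in box (6 ^+ k)) `|(EFin \o sqnorm g) x|)%E = 0%E.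
    under eq_integral do rewrite gee0_abs ?lee_fin ?sqnorm_ge0//.
    rewrite -(@fineK _ (\int[leb]_(x in box (6 ^+ k)) (sqnorm g x)%:E)%E).
      by congr EFin; exact: energy_vanishes.
    by apply: integrable_fin_num => //; exact: box_measurable.
  move/(ae_eq_integral_abs leb (box_measurable _) mq).
  by apply: filterS => x /= + xr => /(_ xr)[].
have : {ae leb, forall x k, box (6 ^+ k) x -> sqnorm g x = 0}.
  by apply/ae_foralln => k; exact: H.
apply: filterS => x Hx.
have : setT x by [].
by rewrite -bigcup_box => -[k _] /Hx.
Qed.

Lemma distr_partial_tensor_eq0 F M i : (forall j, cinf (F j)) ->
  (forall j, supp_in (F j) M) -> distr_of phi (partial i (tensor F)) = 0.
Proof.
move=> cF sF; have [_ Lg wgE] := wg.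
have := wgE i _ (test_function_tensor cF sF).
rewrite /distr_partial => /eqP; rewrite eqr_oppLR => /eqP ->.
apply/eqP; rewrite oppr_eq0; apply/eqP.
rewrite /distr_of /Rintegral (_ : (\int[_]_x _)%E = 0%E)//.
rewrite -[RHS](integral0 leb setT); apply: ae_eq_integral => //.
- have /integrableP[] // := integrable_mul_tensor (Lg i) cF sF.
- apply: filterS sqnorm_ae0 => x q0 _ /=.
  suff -> : g i x = 0 by rewrite mul0r.
  apply/eqP; rewrite -sqrf_eq0 eq_le sqr_ge0 andbT -q0.
  exact: sqr_le_sqnorm.
Qed.

End vanishing_energy.

(** * Functions with vanishing integral over boxes *)
Section density.
Context d (T : measurableType d) (R : realType) (mu : {measure set T -> \bar R}).
Variable f : T -> \bar R.
Hypotheses (mf : measurable_fun setT f) (f0 : forall x, (0 <= f x)%E).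

(** The two proofs are arguments so that the set function can carry a canonical
    structure of measure. *)
Definition density of measurable_fun setT f & (forall x, (0 <= f x)%E) :=
  fun A : set T => (\int[mu]_(x in A) f x)%E.

Local Notation dens := (density mf f0).

Let dens0 : dens set0 = 0%E.
Proof. exact: integral_set0. Qed.

Let dens_ge0 A : (0 <= dens A)%E.
Proof. by apply: integral_ge0. Qed.

Let dens_sigma_additive : semi_sigma_additive dens.
Proof.
move=> F mF tF mUF; rewrite /density ge0_integral_bigcup//; last first.
  exact: measurable_funTS.
by apply: is_cvg_nneseries => n _ _; apply: integral_ge0.
Qed.

HB.instance Definition _ := isMeasure.Build _ _ _ dens
  dens0 dens_ge0 dens_sigma_additive.

End density.

Section constancy.
Context {R : realType} {N : nat}.
Implicit Types (F : 'I_N -> R -> R) (x : 'rV[R]_N) (i j : 'I_N)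
  (a b : 'I_N -> R).
Notation leb := (@lebesgue_rV R N).
Notation mu := (@lebesgue_measure R).

Definition open_box a b : set 'rV[R]_N := [set x | forall i, a i < x ord0 i < b i].

Lemma open_box_itv a b :
  open_box a b = [set x | forall i, `]a i, b i[%classic (x ord0 i)].
Proof. by apply/seteqP; split => x xb i; have := xb i; rewrite /= in_itv. Qed.

Lemma open_box_measurable a b : measurable (open_box a b).
Proof.
by rewrite open_box_itv; apply: (@rV_box_measurable _ _ (fun i => `]a i, b i[%classic)).
Qed.

Lemma leb_open_box a b : (forall i, a i <= b i) ->
  leb (open_box a b) = (\prod_(i < N) (b i - a i))%:E.
Proof.
move=> ab; rewrite open_box_itv (@lebesgue_rV_box R N (fun i => `]a i, b i[%classic))//.
rewrite -prodEFin; apply: eq_bigr => i _.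
rewrite lebesgue_measure_itv/= lte_fin; case: ltP => // ba.
by congr EFin; have := ab i; lra.
Qed.

Lemma open_box_sub_box a b : exists M, open_box a b `<=` box M.
Proof.
exists (\sum_(i < N) (`|a i| + `|b i|)) => x xab i.
apply: (@le_trans _ _ (`|a i| + `|b i|)); last first.
  by rewrite (bigD1 i)//= lerDl sumr_ge0// => j _; rewrite addr_ge0.
have /andP[ax xb] := xab i; rewrite ler_norml.
have := ler_norm (b i); have := lerNnormlW (lexx `|a i|).
have := normr_ge0 (a i); have := normr_ge0 (b i).
lra.
Qed.

Lemma open_boxI a b a' b' : open_box a b `&` open_box a' b' =
  open_box (fun i => Num.max (a i) (a' i)) (fun i => Num.min (b i) (b' i)).
Proof.
apply/seteqP; split => [x [xa xb] i|x xab].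
  by rewrite gt_max lt_min; have /andP[-> ->] := xa i; have /andP[-> ->] := xb i.
by split => i; have := xab i; rewrite gt_max lt_min => /andP[/andP[? ?] /andP[? ?]]; apply/andP.
Qed.

Definition open_boxes : set (set 'rV[R]_N) := [set A | exists a b, A = open_box a b].

Lemma bigcup_open_box : \bigcup_k open_box (fun=> - k%:R) (fun=> k%:R) = setT.
Proof.
apply/seteqP; split => // x _.
pose M := \sum_(i < N) `|x ord0 i|.
exists (Num.truncn M).+1 => // i; rewrite -ltr_norml.
apply: le_lt_trans (truncnS_gt M).
by rewrite /M (bigD1 i)//= lerDl sumr_ge0.
Qed.

(** A half-space x_i > c is the union of the boxes with lower bound c in
    direction i and all other bounds -k and k. *)
Lemma measurable_open_boxesE : @measurable _ 'rV[R]_N = <<s open_boxes >>.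
Proof.
apply/seteqP; split; last first.
  apply: smallest_sub; first exact: sigma_algebra_measurable.
  by move=> _ [a [b ->]]; exact: open_box_measurable.
apply: smallest_sub; first exact: smallest_sigma_algebra.
rewrite -bigcup_seq => A [i _] [B mB <-{A}].
have : measurable_fun (setT : set (g_sigma_algebraType open_boxes))
    (fun x : 'rV[R]_N => x ord0 i).
  apply: (measurability _ (RGenOInfty.measurableE R)).
  move=> _ [_ [c ->] <-]; rewrite setTI.
  have -> : (fun x : 'rV[R]_N => x ord0 i) @^-1` `]c, +oo[ =
      \bigcup_k open_box (fun j => if j == i then c else - k%:R) (fun=> k%:R).
    apply/seteqP; split => [x /=|x [k _ /(_ i)] /=]; last first.
      by rewrite eqxx in_itv/= andbT => /andP[].
    rewrite in_itv/= andbT => cx.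
    have : setT x by [].
    rewrite -bigcup_open_box => -[k _ xk]; exists k => // j.
    by have /andP[x1 x2] := xk j; rewrite x2 andbT; case: eqP => [->|].
  apply: bigcupT_measurable => k; apply: sub_sigma_algebra.
  by exists (fun j => if j == i then c else - k%:R), (fun=> k%:R).
move/(_ measurableT B mB); by rewrite setTI.
Qed.

Section vanishing.
Variable v : 'rV[R]_N -> R.
Hypotheses (mv : measurable_fun setT v)
  (iv_box : forall M, leb.-integrable (box M) (EFin \o v))
  (v0 : forall a b, (\int[leb]_(x in open_box a b) v x)%R = 0).

(** The measures with densities the positive and the negative part of v agree on
    boxes, which form a generating family stable under intersection; hence they
    agree on all measurable sets, and the two parts agree almost everywhere. *)
Lemma ae_eq0_of_open_box : {ae leb, forall x, v x = 0}.
Proof.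
have mEv : measurable_fun setT (EFin \o v) by exact/measurable_EFinP.
have iv a b : leb.-integrable (open_box a b) (EFin \o v).
  have [M abM] := open_box_sub_box a b.
  apply: integrableS abM (iv_box M) => //.
    exact: box_measurable.
  exact: open_box_measurable.
pose p := (EFin \o v)^\+%E; pose n := (EFin \o v)^\-%E.
have mp : measurable_fun setT p by exact: measurable_funepos.
have mn : measurable_fun setT n by exact: measurable_funeneg.
have p0 x : (0 <= p x)%E by exact: funepos_ge0.
have n0 x : (0 <= n x)%E by exact: funeneg_ge0.
have fin_p a b : (\int[leb]_(x in open_box a b) p x)%E \is a fin_num.
  exact: (integrable_pos_fin_num (open_box_measurable a b) (iv a b)).
have fin_n a b : (\int[leb]_(x in open_box a b) n x)%E \is a fin_num.
  exact: (integrable_neg_fin_num (open_box_measurable a b) (iv a b)).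
have pn A : measurable A -> density leb mp p0 A = density leb mn n0 A.
{ apply: (measure_unique open_boxes (fun k => open_box (fun=> - k%:R) (fun=> k%:R))).
  - exact: measurable_open_boxesE.
  - by move=> _ _ [a [b ->]] [a' [b' ->]]; rewrite open_boxI; do 2 eexists.
  - by move=> k; do 2 eexists.
  - exact: bigcup_open_box.
  - move=> _ [a [b ->]]; rewrite /= /density.
    have := v0 a b; rewrite /Rintegral integralE -/p -/n fineB//.
    move/eqP; rewrite subr_eq0 => /eqP pnE.
    by rewrite -[LHS](fineK (fin_p a b)) pnE fineK.
  - by move=> k; rewrite /= /density ltey_eq fin_p. }
have H k : {ae leb, forall x, open_box (fun=> - k%:R) (fun=> k%:R) x -> v x = 0}.
  have mk := open_box_measurable (fun=> - k%:R) (fun=> k%:R).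
  have ip : leb.-integrable (open_box (fun=> - k%:R) (fun=> k%:R)) p.
    exact: (integrable_funepos mk (iv _ _)).
  have := integral_ae_eq mk ip (measurable_funTS mn)
    (fun E _ mE => pn E mE).
  apply: filterS => x /= + xk => /(_ xk) /eqP pnx.
  move: pnx; rewrite /p /n funeposE funenegE /= -!EFin_max eqe => /eqP.
  by case: (leP (v x) 0); case: (leP (- v x) 0); lra.
have : {ae leb, forall x k, open_box (fun=> - k%:R) (fun=> k%:R) x -> v x = 0}.
  by apply/ae_foralln => k; exact: H.
apply: filterS => x Hx.
have : setT x by [].
by rewrite -bigcup_open_box => -[k _] /Hx.
Qed.

End vanishing.
End constancy.

(** * Functions with vanishing weak gradient *)
Section zero_gradient.
Context {R : realType} {N : nat}.
Implicit Types (F : 'I_N -> R -> R) (x : 'rV[R]_N) (i j : 'I_N)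
  (a b : 'I_N -> R).
Notation leb := (@lebesgue_rV R N).
Notation mu := (@lebesgue_measure R).

Lemma supp_in_le (f : R -> R) M M' : M <= M' -> supp_in f M -> supp_in f M'.
Proof. by move=> MM fM x /(le_lt_trans MM) /fM. Qed.

Variable u : 'rV[R]_N -> R.
Hypotheses (Lu : Lp_loc 1 u) (du : forall F M i, (forall j, cinf (F j)) ->
  (forall j, supp_in (F j) M) -> distr_of u (partial i (tensor F)) = 0).
Variable rho : R -> R.
Hypotheses (crho : cinf rho) (srho : supp_in rho 1)
  (irho : (\int[mu]_t rho t)%R = 1).

(** F_i - (\int F_i) rho has integral zero, so it is the derivative of a
    compactly supported smooth function, and the corresponding product is a
    partial derivative of a test function. *)
Lemma distr_of_swap F M i : 1 <= M -> (forall j, cinf (F j)) ->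
  (forall j, supp_in (F j) M) ->
  distr_of u (tensor F) =
  (\int[mu]_t F i t)%R * distr_of u (tensor (set_at i rho F)).
Proof.
move=> M1 cF sF; set m := (\int[mu]_t F i t)%R.
have srhoM : supp_in rho M by exact: supp_in_le srho.
pose psi t := F i t + (- m) * rho t.
have cpsi : cinf psi.
  apply: (@cinf_add _ (F i) (fun t => - m * rho t)) => //.
  by apply: (@cinf_mul _ (cst (- m))) => //; exact: cinf_cst.
have spsi : supp_in psi M by move=> t tM; rewrite /psi sF// srhoM// mulr0 addr0.
have ipsi : (\int[mu]_t psi t)%R = 0.
  have iF := continuous_supp_integrable (cinf_continuous (cF i)) (sF i).
  have ir := continuous_supp_integrable (cinf_continuous crho) srho.
  rewrite RintegralD//; last first.
    rewrite (_ : _ \o _ = (fun t => (- m)%:E * (EFin \o rho) t)%E).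
      exact: integrableZl.
    by apply/funext.
  by rewrite RintegralZl// irho mulr1 subrr.
have [H [cH dH H0 H1]] := cinf_antiderivative cpsi spsi.
have sH : supp_in H M.
  move=> t; rewrite ltr_normr => /orP[tM|tM]; last by rewrite H0// ltrNr.
  by rewrite H1 ?ipsi// ltW.
have c_set (h : R -> R) : cinf h -> forall j, cinf (set_at i h F j).
  by move=> ch j; rewrite /set_at; case: ifP.
have s_set (h : R -> R) : supp_in h M -> forall j, supp_in (set_at i h F j) M.
  by move=> sh j; rewrite /set_at; case: ifP.
have := du i (c_set H cH) (s_set H sH).
rewrite partial_tensor; last exact: c_set.
have -> : set_at i (derive1 (set_at i H F i)) (set_at i H F) = set_at i psi F.
  apply/funext => j; rewrite /set_at eqxx; have [_|//] := eqVneq j i.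
  exact: is_derive_derive1.
have uF := integrable_mul_tensor Lu cF sF.
have ur := integrable_mul_tensor Lu (c_set rho crho) (s_set rho srhoM).
have -> : distr_of u (tensor (set_at i psi F)) =
    distr_of u (tensor F) - m * distr_of u (tensor (set_at i rho F)).
  rewrite /distr_of -RintegralZl// -RintegralB//.
    apply: eq_Rintegral => x _; rewrite !tensor_set_at (tensor_bigD1 _ i) /psi; ring.
  rewrite (_ : _ \o _ = (fun x => m%:E *
      (EFin \o (fun x => (u x * tensor (set_at i rho F) x)%R)) x)%E).
    exact: integrableZl.
  by apply/funext.
by move/eqP; rewrite subr_eq0 => /eqP.
Qed.

(** All the factors are replaced one after the other, along any enumeration of
    the coordinates. *)
Lemma distr_of_tensor F M : 1 <= M -> (forall j, cinf (F j)) ->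
  (forall j, supp_in (F j) M) ->
  distr_of u (tensor F) =
  (\prod_(i < N) \int[mu]_t F i t)%R * distr_of u (tensor (fun=> rho)).
Proof.
move=> M1 cF sF.
pose rep (s : seq 'I_N) j := if j \in s then rho else F j.
have srhoM : supp_in rho M by exact: supp_in_le srho.
have key (s : seq 'I_N) : uniq s -> distr_of u (tensor F) =
    (\prod_(i <- s) \int[mu]_t F i t)%R * distr_of u (tensor (rep s)).
  elim: s => [_|i s IH /= /andP[is_ us]]; first by rewrite big_nil mul1r.
  have crep j : cinf (rep s j) by rewrite /rep; case: ifP.
  have srep j : supp_in (rep s j) M by rewrite /rep; case: ifP.
  rewrite IH// big_cons (distr_of_swap i M1 crep srep).
  rewrite {1}/rep (negbTE is_) mulrCA mulrA; congr (_ * distr_of u (tensor _)).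
  by apply/funext => j; rewrite /set_at /rep inE; case: eqP.
rewrite (key _ (index_enum_uniq _)); congr (_ * distr_of u (tensor _)).
by apply/funext => j; rewrite /rep mem_index_enum.
Qed.

(** The product formula is applied to pulses and passes to the limit by dominated
    convergence, their products being bounded by the indicator of the box. *)
Lemma Rintegral_open_box a b :
  (\int[leb]_(x in open_box a b) u x)%R =
  distr_of u (tensor (fun=> rho)) * fine (leb (open_box a b)).
Proof.
have [ab|] := boolP [forall i, a i <= b i]; last first.
  rewrite negb_forall => /existsP[i]; rewrite -ltNge => ba.
  have -> : open_box a b = set0.
    apply/seteqP; split => // x /(_ i) /andP[ax xb].
    by have := lt_trans ax xb; rewrite ltNge (ltW ba).
  by rewrite Rintegral_set0 measure0 mulr0.
move/forallP in ab; rewrite leb_open_box//=.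
pose F (n : nat) i := pulse (a i) (b i) n.
pose M := 1 + \sum_(i < N) (`|a i| + `|b i|).
have M1 : 1 <= M by rewrite lerDl sumr_ge0// => i _; rewrite addr_ge0.
have cF n j : cinf (F n j) by exact: cinf_pulse.
have sF n j : supp_in (F n j) M.
  apply: supp_in_le (@pulse_supp _ _ _ _).
  have : `|a j| + `|b j| <= \sum_(i < N) (`|a i| + `|b i|).
    by rewrite (bigD1 j)//= lerDl sumr_ge0// => i _; rewrite addr_ge0.
  have := normr_ge0 (a j); have := normr_ge0 (b j).
  by rewrite /M ge_max; lra.
have cvg_prod (h : 'I_N -> nat -> R) (l : 'I_N -> R) :
    (forall i, h i @ \oo --> l i) ->
    (fun n => \prod_(i < N) h i n) @ \oo --> \prod_(i < N) l i.
  move=> hl; elim: (index_enum _) => [|i r IH].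
    by rewrite big_nil; under eq_fun do rewrite big_nil; exact: cvg_cst.
  rewrite big_cons; under eq_fun do rewrite big_cons.
  by apply: cvgM; [exact: hl|exact: IH].
have mo := open_box_measurable a b.
have iu : leb.-integrable (open_box a b) (EFin \o u).
  have [K abK] := open_box_sub_box a b.
  apply: integrableS abK (Lp_loc1_integrable_box K Lu) => //.
  exact: box_measurable.
have lim1 : (fun n => distr_of u (tensor (F n))) @ \oo -->
    (\int[leb]_(x in open_box a b) u x)%R.
{ rewrite Rintegral_mkcond.
  apply: (@Rintegral_dominated_cvg _ _ _ leb _ _ ((fun x => `|u x|) \_ (open_box a b))).
  - move=> n; apply: measurable_funM; first by case: Lu.
    exact: measurable_tensor.
  - move=> x; have -> : (u \_ (open_box a b)) x =
        u x * \prod_(i < N) (\1_(`]a i, b i[) (x ord0 i) : R).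
      rewrite patchE; case: ifPn => [/set_mem xab|].
        rewrite big1 ?mulr1// => i _; rewrite indicE mem_set//=.
        by rewrite in_itv/=; exact: xab.
      rewrite notin_setE => /existsNP[i xi].
      rewrite (bigD1 i)//= indicE memNset; last by rewrite /= in_itv.
      by rewrite mul0r mulr0.
    by apply: cvgMr; apply: cvg_prod => i; exact: pulse_cvg.
  - rewrite -restrict_EFin -integrable_mkcond//.
    exact: (integrable_norm iu).
  - move=> n x; rewrite patchE normrM; case: ifPn => [_|].
      rewrite ler_piMr// normr_prod; apply: prodr_ile1 => i _.
      by have /andP[p0 p1] := pulse_bounds (a i) (b i) n (x ord0 i); rewrite ger0_norm// p0.
    rewrite notin_setE => /existsNP[i /negP xi].
    by rewrite (tensor_bigD1 _ i) /F pulse_out// mul0r normr0 mulr0. }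
have lim2 : (fun n => distr_of u (tensor (F n))) @ \oo -->
    (\prod_(i < N) (b i - a i)) * distr_of u (tensor (fun=> rho)).
  under eq_fun => n do rewrite (distr_of_tensor M1 (cF n) (sF n)).
  by apply: cvgMl; apply: cvg_prod => i; exact: pulse_integral_cvg.
rewrite mulrC; exact: (cvg_unique _ lim1 lim2).
Qed.

Lemma ae_cst_of_zero_gradient : exists c, {ae leb, forall x, u x = c}.
Proof.
pose c := distr_of u (tensor (fun=> rho)); exists c.
have leb_fin M : (leb (box M) < +oo)%E.
  apply: (@le_lt_trans _ _ (leb (box `|M|))); last by rewrite leb_box ?ltry.
  apply: (le_measure _ (mem_set (box_measurable M)) (mem_set (box_measurable _))).
  by move=> x xM i; exact: le_trans (xM i) (ler_norm _).
have c_int A M : measurable A -> A `<=` box M -> leb.-integrable A (EFin \o cst c).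
  move=> mA AM; apply: measurable_bounded_integrable => //; last exact: bounded_cst.
  apply: le_lt_trans (leb_fin M).
  exact: (le_measure _ (mem_set mA) (mem_set (box_measurable _))).
have [mu_ _] := Lu.
apply: (filterS _ (@ae_eq0_of_open_box R N (u \- cst c) _ _ _)).
- by move=> x /eqP; rewrite subr_eq0 => /eqP.
- exact: measurable_funB.
- move=> M; have mB := @box_measurable R N M.
  exact: (integrableB mB (Lp_loc1_integrable_box M Lu) (c_int _ M mB (@subset_refl _ _))).
- move=> a b; have [M abM] := open_box_sub_box a b.
  have mo := open_box_measurable a b.
  have iu : leb.-integrable (open_box a b) (EFin \o u).
    apply: integrableS abM (Lp_loc1_integrable_box M Lu) => //.
    exact: box_measurable.
  rewrite (RintegralB mo iu (c_int _ M mo abM)).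
  by rewrite Rintegral_open_box Rintegral_cst// subrr.
Qed.
End zero_gradient.

Theorem theorem2 (R : realType) (N : nat) (hN : (N = 1%N) \/ (N = 2%N))
  (phi : 'rV[R]_N -> R) (hphi : H1_loc phi) (hsol : distr_solution phi) :
  exists c : R, {ae lebesgue_rV N, forall x, phi x = c}.
Proof.
have N2 : (N <= 2)%N by case: hN => ->.
have [g [wg Lq sol]] := hsol; have [Lphi _ _] := wg.
have [rho [crho srho irho]] := @exists_unit_bump R.
apply: (ae_cst_of_zero_gradient Lphi _ crho srho irho) => F M i.
exact: (distr_partial_tensor_eq0 N2 wg Lq sol).
Qed.
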